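(* For every constant $d>0$ and every constant $A>0$ there exist constants $c_0$ and $K$ such that the following holds. Let $n,k\ge1$, let $c\ge c_0$ be an integer, let $R\ge1$ satisfy $\log k\le AR$, and let $\widehat{x}$ be the Count-Sketch estimate of $x\in\mathbb{R}^n$ using $R$ rows and $C=ck$ columns with fully random hash functions. Then for every nonempty $S\subset[n]$ with $|S|\le k$, \[ \Pr\left[\|\widehat{x}_S-x_S\|_2^2 > |S|\cdot\frac{1}{R}\cdot\frac{\|x_{\overline{[k]}}\|_2^2}{k}\right]\le \frac{K}{|S|^{d}}. \]
   Context: Count-Sketch with $R$ rows and $C$ columns: for each row $u\in[R]$ choose hash functions $h_u:[n]\to[C]$ and $s_u:[n]\to\{\pm1\}$; ''fully random'' means all values $h_u(i)$ (uniform on $[C]$) and $s_u(i)$ (uniform on $\{\pm1\}$) are mutually independent. The sketch is $y_{u,v}=\sum_{i:h_u(i)=v}s_u(i)x_i$ and the estimate is $\widehat{x}_i=\operatorname{median}_{u\in[R]} s_u(i)\,y_{u,h_u(i)}$ (average of the two middle values for even $R$). $z_S$ is the restriction of $z$ to the coordinates in $S$; $x_{\overline{[k]}}$ denotes $x$ with its $k$ largest-magnitude coordinates replaced by $0$. *)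

(* Defs.v *)
From HB Require Import structures.
From mathcomp Require Import all_boot all_order all_algebra.
From mathcomp Require Import all_classical all_reals.
From mathcomp Require Import exp.
Set Implicit Arguments. Unset Strict Implicit. Unset Printing Implicit Defensive.
Import Order.TTheory GRing.Theory Num.Theory.
Local Open Scope ring_scope.

Section CountSketch.
Variable F : realType.

Definition sgnb (b : bool) : F := if b then 1 else -1.

Definition median (s : seq F) : F :=
  let t := sort <=%R s in
  let m := size s in
  if odd m then t`_(m./2) else (t`_(m./2).-1 + t`_(m./2)) / 2.

(* hash functions: h u i in [C], s u i in {+-1} *)
Definition hashes (R n C : nat) : finType :=
  ({ffun 'I_R -> {ffun 'I_n -> 'I_C}} * {ffun 'I_R -> {ffun 'I_n -> bool}})%type.

Definition sketch (R n C : nat) (w : hashes R n C) (x : 'I_n -> F)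
    (u : 'I_R) (v : 'I_C) : F :=
  \sum_(i < n | w.1 u i == v) sgnb (w.2 u i) * x i.

Definition cs_estimate (R n C : nat) (w : hashes R n C) (x : 'I_n -> F)
    (i : 'I_n) : F :=
  median [seq sgnb (w.2 u i) * sketch w x u (w.1 u i) | u <- enum 'I_R].

(* || x_{bar [k]} ||_2^2 : squared norm of x after zeroing its k
   largest-magnitude coordinates *)
Definition tail_sq (n : nat) (x : 'I_n -> F) (k : nat) : F :=
  \sum_(v <- drop k (sort >=%R [seq `|x i| | i <- enum 'I_n])) v ^+ 2.

Definition prob (R n C : nat) (E : pred (hashes R n C)) : F :=
  #|[set w | E w]|%:R / #|hashes R n C|%:R.

End CountSketch.

(* Main.v *)
(* For i in S let e_u be the error of row u at i.  If the median error exceeds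
   lam, then the sum over u of the signs of those e_u with |e_u| > lam is, in
   absolute value, at least the number of rows with |e_u| <= lam.  Both sides
   are controlled jointly over all i in S, by products of one-element bounds.
   - Imbalance of signs: given the buckets, flipping all signs makes every term
     centred, and distinct buckets are independent, so the vector of sign sums
     is subgaussian up to the number of elements of S in a bucket.
   - Number of small errors: pair each bucket with its mirror image.  Given the
     pairs, an element lands in the bucket of i with probability 1/2 and a
     random sign, so e_u has the law of Y - Y' with Y, Y' iid, and the
     pigeonhole principle gives P(|e_u| <= lam) >= lam / (8 l), where l^2 bounds
     the squared norm of the elements in the pair.  Distinct pairs are
     independent.
   With dyadic levels lam, these product bounds control the exponential moment
   of the sum of the squared errors, which exceeds its target with probability
   at most exp (- |S|).  What remains is a union bound over S for the events
   that many rows are bad for i (a collision with S or with a large coordinate,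
   or too much mass in the pair) or that the buckets of i hold many elements of
   S; for large c each costs exp (- A (1 + d) R) <= k^-(1+d). *)

Require Import Defs.
From HB Require Import structures.
From mathcomp Require Import all_boot all_order all_algebra.
From mathcomp Require Import all_classical all_reals.
From mathcomp Require Import sequences exp.
From mathcomp Require Import ring lra zify.
Import Order.TTheory GRing.Theory Num.Theory.
Local Open Scope ring_scope.
Set Implicit Arguments.
Unset Strict Implicit.
Unset Printing Implicit Defensive.

(** * Expectation, product measures and independence on finite types *)

Section Average.
Variable F : realType.

(** Expectation under the uniform measure. On an empty type it is 0, hence the nonemptiness
    conditions below. *)
Definition avg (T : finType) (f : T -> F) : F := (\sum_x f x) / #|T|%:R.

Lemma eq_avg (T : finType) (f g : T -> F) : f =1 g -> avg f = avg g.
Proof. by move=> fg; rewrite /avg (eq_bigr _ (fun x _ => fg x)). Qed.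

Lemma ler_avg (T : finType) (f g : T -> F) :
  (forall x, f x <= g x) -> avg f <= avg g.
Proof.
move=> fg; rewrite /avg ler_wpM2r ?invr_ge0 ?ler0n //.
by apply: ler_sum => x _; exact: fg.
Qed.

Lemma avg_ge0 (T : finType) (f : T -> F) : (forall x, 0 <= f x) -> 0 <= avg f.
Proof. by move=> f0; rewrite /avg mulr_ge0 ?invr_ge0 ?ler0n ?sumr_ge0. Qed.

Lemma avgD (T : finType) (f g : T -> F) :
  avg (fun x => f x + g x) = avg f + avg g.
Proof. by rewrite /avg big_split mulrDl. Qed.

Lemma avgZ (T : finType) (a : F) (f : T -> F) :
  avg (fun x => a * f x) = a * avg f.
Proof. by rewrite /avg -mulr_sumr mulrA. Qed.

Lemma avg_sum (T K : finType) (P : pred K) (f : K -> T -> F) :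
  avg (fun x => \sum_(k | P k) f k x) = \sum_(k | P k) avg (f k).
Proof. by rewrite /avg exchange_big /= mulr_suml. Qed.

Lemma avg_cst (T : finType) (a : F) : (0 < #|T|)%N -> avg (fun _ : T => a) = a.
Proof.
by move=> T0; rewrite /avg sumr_const -[a *+ _]mulr_natr mulfK // pnatr_eq0 -lt0n.
Qed.

Lemma avg_reindex (T : finType) (h : T -> T) (f : T -> F) :
  injective h -> avg (fun x => f (h x)) = avg f.
Proof. by move=> hI; rewrite /avg [in RHS](reindex_inj hI). Qed.

Lemma avg_bij (T U : finType) (h : T -> U) (f : U -> F) :
  bijective h -> avg (fun x => f (h x)) = avg f.
Proof.
move=> hB; rewrite /avg (bij_eq_card hB).
by rewrite [in RHS](reindex h) //; exact: onW_bij.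
Qed.

Lemma avg_pair (T U : finType) (f : T * U -> F) :
  avg f = avg (fun x => avg (fun y => f (x, y))).
Proof.
rewrite /avg -mulr_suml pair_bigA card_prod natrM invfM mulrA mulrAC.
by congr (_ / _ / _); apply: eq_bigr => -[].
Qed.

Lemma exchange_avg (T U : finType) (f : T -> U -> F) :
  avg (fun x => avg (f x)) = avg (fun y => avg (f^~ y)).
Proof.
by rewrite /avg -!mulr_suml exchange_big /= mulrAC.
Qed.

(** Each injective self-map of a finite type preserves the uniform measure. This serves as
    conditioning: a random action resamples part of [w], and the inner average is then bounded for
    each fixed [w]. *)
Lemma avg_act (T A : finType) (act : A -> T -> T) (f : T -> F) :
  (0 < #|A|)%N -> (forall a, injective (act a)) ->
  avg f = avg (fun w => avg (fun a => f (act a w))).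
Proof.
move=> A0 actI; rewrite exchange_avg.
rewrite -[LHS](avg_cst (avg f) A0); apply: eq_avg => a.
by rewrite (avg_reindex f (actI a)).
Qed.

Lemma avg_markov (T : finType) (E : pred T) (f : T -> F) (b : F) :
  0 < b -> (forall x, 0 <= f x) -> (forall x, E x -> b <= f x) ->
  avg (fun x => (E x)%:R) <= avg f / b.
Proof.
move=> b0 f0 Ef; rewrite mulrC -avgZ; apply: ler_avg => x.
case Ex: (E x); last by rewrite mulr_ge0 ?invr_ge0 // ltW.
by rewrite mulrC ler_pdivlMr // mul1r Ef.
Qed.

Lemma avg_ffun_prod (I T : finType) (G : I -> T -> F) :
  avg (fun w : {ffun I -> T} => \prod_x G x (w x)) = \prod_x avg (G x).
Proof.
rewrite /avg big_split /= prodr_const card_ffun natrX -exprVn.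
by rewrite -bigA_distr_bigA.
Qed.

Lemma avg_coord (I T : finType) (x : I) (g : T -> F) : (0 < #|T|)%N ->
  avg (fun w : {ffun I -> T} => g (w x)) = avg g.
Proof.
move=> T0.
have := avg_ffun_prod (fun y t => if y == x then g t else 1).
rewrite (bigD1 x) //= eqxx [X in _ * X]big1 ?mulr1; last first.
  by move=> y /negbTE ->; rewrite avg_cst.
move=> <-; apply: eq_avg => w.
by rewrite (bigD1 x) //= eqxx big1 ?mulr1 // => y /negbTE ->.
Qed.

Lemma avg_coord2 (I T : finType) (x y : I) (g h : T -> F) : (0 < #|T|)%N ->
  x != y ->
  avg (fun w : {ffun I -> T} => g (w x) * h (w y)) = avg g * avg h.
Proof.
move=> T0 xy; have yx : y != x by rewrite eq_sym.
have := avg_ffun_prod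
  (fun z t => if z == x then g t else if z == y then h t else 1).
rewrite (bigD1 x) //= eqxx (bigD1 y) //= (negbTE yx) eqxx.
rewrite [X in _ * (_ * X)]big1 ?mulr1; last first.
  by move=> z /andP[/negbTE -> /negbTE ->]; rewrite avg_cst.
move=> <-; apply: eq_avg => w.
rewrite (bigD1 x) //= eqxx (bigD1 y) //= (negbTE yx) eqxx.
by rewrite big1 ?mulr1 // => z /andP[/negbTE -> /negbTE ->].
Qed.

Definition depends_on (I T : finType) (A : {set I}) (f : {ffun I -> T} -> F) :=
  forall a b : {ffun I -> T}, {in A, a =1 b} -> f a = f b.

(* Swapping the coordinates in A between two independent copies preserves
   the uniform measure on pairs. *)
Lemma avg_indep2 (I T : finType) (A : {set I}) (f g : {ffun I -> T} -> F) :
  (0 < #|T|)%N -> depends_on A f -> depends_on (~: A) g ->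
  avg (fun w => f w * g w) = avg f * avg g.
Proof.
move=> T0 fA gA.
have W0 : (0 < #|{ffun I -> T}|)%N by rewrite card_ffun expn_gt0 T0.
pose mix (a b : {ffun I -> T}) := [ffun x => if x \in A then a x else b x].
pose swap (p : {ffun I -> T} * {ffun I -> T}) := (mix p.1 p.2, mix p.2 p.1).
have swapK : involutive swap.
  case=> a b; apply: (f_equal2 pair);
    by apply/ffunP => x; rewrite /swap /mix /= !ffunE; case: (x \in A).
have sum2 (h : {ffun I -> T} -> {ffun I -> T} -> F) :
    \sum_a \sum_b h a b = \sum_a \sum_b h (mix a b) (mix b a).
  rewrite !pair_bigA /= (reindex_inj (inv_inj swapK)) /=.
  by apply: eq_bigr => -[].
have : \sum_a \sum_b f a * g b = \sum_a \sum_(b : {ffun I -> T}) f a * g a.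
  rewrite [RHS](sum2 (fun a b => f a * g a)); apply: eq_bigr => a _; apply: eq_bigr => b _.
  congr (_ * _); [apply: fA|apply: gA] => x; rewrite ?inE /mix !ffunE.
    by move=> ->.
  by move=> /negbTE ->.
under eq_bigr do rewrite -mulr_sumr.
rewrite -mulr_suml => E.
have {}E : (\sum_a f a) * (\sum_a g a) =
    (\sum_a f a * g a) * #|{ffun I -> T}|%:R.
  rewrite E mulr_suml; apply: eq_bigr => a _.
  by rewrite sumr_const -[LHS]mulr_natr.
by rewrite /avg mulrACA E mulrA mulfK // pnatr_eq0 -lt0n.
Qed.

Lemma avg_indep (I T K : finType) (P : pred K) (A : K -> {set I})
    (f : K -> {ffun I -> T} -> F) : (0 < #|T|)%N ->
  (forall k l, P k -> P l -> k != l -> [disjoint A k & A l]) ->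
  (forall k, P k -> depends_on (A k) (f k)) ->
  avg (fun w => \prod_(k | P k) f k w) = \prod_(k | P k) avg (f k).
Proof.
move=> T0 dA fA.
have W0 : (0 < #|{ffun I -> T}|)%N by rewrite card_ffun expn_gt0 T0.
rewrite -[RHS]big_filter; under eq_avg do rewrite -big_filter.
have : uniq [seq k <- index_enum K | P k] by rewrite filter_uniq ?index_enum_uniq.
have : all P [seq k <- index_enum K | P k] by rewrite filter_all.
elim: [seq k <- _ | P k] => [_ _|k s IH /= /andP[Pk Ps] /andP[ks us]].
  by rewrite big_nil; under eq_avg do rewrite big_nil; rewrite avg_cst.
rewrite big_cons -IH //; under eq_avg do rewrite big_cons.
(* By disjointness the remaining product reads only coordinates outside [A k]. *)
apply: (avg_indep2 T0 (fA _ Pk)) => a b ab.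
rewrite !big_seq; apply: eq_bigr => l ls; apply: fA => [|x xA].
  exact: (allP Ps).
apply: ab; rewrite inE; apply/negP => xk.
have kl : k != l by apply: contraNneq ks => ->.
have := dA _ _ Pk (allP Ps _ ls) kl.
by move/disjointFr => /(_ _ xk); rewrite xA.
Qed.

End Average.

(** * Random signs: second moments, small balls, exponential moments *)

Section Signs.
Variable F : realType.

Lemma sgnb_eq (a b : bool) : sgnb F (a == b) = sgnb F a * sgnb F b.
Proof. by case: a; case: b; rewrite /sgnb /= ?mul1r ?mulr1 // mulrNN mulr1. Qed.

Lemma sgnb_sq (a : bool) : sgnb F a * sgnb F a = 1.
Proof. by case: a; rewrite /sgnb ?mulrNN mulr1. Qed.

Lemma sgnbN (a : bool) : sgnb F (~~ a) = - sgnb F a.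
Proof. by case: a; rewrite /sgnb //= opprK. Qed.

Lemma normr_sgnb (a : bool) : `|sgnb F a| = 1.
Proof. by case: a; rewrite /sgnb /= ?normrN1 ?normr1. Qed.

Lemma avg_sgnb : avg (sgnb F) = 0.
Proof. by rewrite /avg big_bool /= /sgnb subrr mul0r. Qed.

(** Cauchy-Schwarz, from the nonnegativity of the sum of [(N a_k - S)^2]. *)
Lemma sqr_sum_le (K : finType) (P : pred K) (a : K -> F) :
  (\sum_(k | P k) a k) ^+ 2 <= #|P|%:R * \sum_(k | P k) a k ^+ 2.
Proof.
set S := \sum_(k | P k) a k; set N : F := #|P|%:R.
have [N0|N0] := eqVneq #|P| 0.
  rewrite /S /N N0 mul0r big_pred0 ?expr0n // => k.
  by have /card0_eq := N0 => /(_ k).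
have Np : 0 < N by rewrite ltr0n lt0n.
have : 0 <= \sum_(k | P k) (N * a k - S) ^+ 2.
  by apply: sumr_ge0 => k _; exact: sqr_ge0.
have -> : \sum_(k | P k) (N * a k - S) ^+ 2 =
    N * (N * (\sum_(k | P k) a k ^+ 2) - S ^+ 2).
  rewrite (eq_bigr (fun k => N ^+ 2 * a k ^+ 2 - (2 * N * S) * a k + S ^+ 2));
    last by move=> k _; ring.
  rewrite big_split /= sumrB -!mulr_sumr sumr_const -/S.
  by rewrite -[_ *+ #|_|]mulr_natl -/N; ring.
by rewrite pmulr_rge0 // subr_ge0.
Qed.

Lemma avg_rademacher_sq (I : finType) (y : I -> F) :
  avg (fun a : {ffun I -> bool} => (\sum_x sgnb F (a x) * y x) ^+ 2)
  = \sum_x y x ^+ 2.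
Proof.
have B0 : (0 < #|{: bool}|)%N by rewrite card_bool.
have W0 : (0 < #|{ffun I -> bool}|)%N by rewrite card_ffun card_bool expn_gt0.
have -> : avg (fun a : {ffun I -> bool} => (\sum_x sgnb F (a x) * y x) ^+ 2)
    = avg (fun a : {ffun I -> bool} =>
        \sum_x \sum_z (y x * y z) * (sgnb F (a x) * sgnb F (a z))).
  apply: eq_avg => a; rewrite expr2 mulr_suml; apply: eq_bigr => x _.
  by rewrite mulr_sumr; apply: eq_bigr => z _; ring.
rewrite avg_sum; apply: eq_bigr => x _; rewrite avg_sum (bigD1 x) //=.
rewrite big1 ?addr0 => [|z zx].
  rewrite avgZ (@eq_avg _ _ _ (fun=> 1)) ?avg_cst ?mulr1 ?expr2 // => a.
  exact: sgnb_sq.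
by rewrite avgZ (avg_coord2 (sgnb F) (sgnb F)) 1?eq_sym // avg_sgnb !mul0r mulr0.
Qed.

Lemma avg_rademacher_tail (I : finType) (y : I -> F) (l : F) : 0 < l ->
  avg (fun a : {ffun I -> bool} => (l < `|\sum_x sgnb F (a x) * y x|)%R%:R)
  <= (\sum_x y x ^+ 2) / l ^+ 2.
Proof.
move=> l0; rewrite -avg_rademacher_sq; apply: avg_markov => [|a|a la].
- exact: exprn_gt0.
- exact: sqr_ge0.
by rewrite /= -[leRHS]real_normK ?num_real // ler_sqr ?nnegrE ?normr_ge0 // ltW.
Qed.

(* Pigeonhole: with probability 3/4 the two iid sums lie in a common window of
   length 2l, which is covered by at most 3l/lam bins of length lam. *)
Lemma small_ball (I : finType) (y : I -> F) (l lam : F) :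
  0 < lam -> lam <= l -> \sum_x y x ^+ 2 <= l ^+ 2 ->
  lam / (8 * l) <=
  avg (fun b : {ffun I -> bool} => avg (fun b' : {ffun I -> bool} =>
    (`|\sum_x ((b' x)%:R - (b x)%:R) * y x| <= lam)%R%:R)).
Proof.
move=> lam0 laml yl; have l0 : 0 < l by exact: lt_le_trans laml.
have W0 : (0 < #|{ffun I -> bool}|)%N by rewrite card_ffun card_bool expn_gt0.
(* A bit is half its sign plus 1/2, so differences of bits become differences of two iid Rademacher
   sums of variance at most [l^2 / 4]. *)
pose Z (b : {ffun I -> bool}) := \sum_x sgnb F (b x) * (y x / 2).
have ZE (b b' : {ffun I -> bool}) : \sum_x ((b' x)%:R - (b x)%:R) * y x = Z b' - Z b.
  rewrite /Z -sumrB; apply: eq_bigr => x _.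
  by case: (b x); case: (b' x); rewrite /sgnb /=; lra.
under eq_avg do under eq_avg do rewrite ZE.
pose N := Num.truncn (2 * l / lam).
pose bin b := Num.truncn ((Z b + l) / lam).
pose p (m : 'I_N.+1) := avg (fun b => ((`|Z b| <= l)%R && (bin b == m))%:R : F).
have binN b : `|Z b| <= l -> (bin b < N.+1)%N.
  move=> Zl; rewrite ltnS; apply: le_truncn.
  by rewrite ler_pM2r ?invr_gt0 //; move: Zl; rewrite ler_norml; lra.
have p34 : 3 / 4 <= \sum_m p m.
  have -> : \sum_m p m = avg (fun b => (`|Z b| <= l)%R%:R : F).
    rewrite -avg_sum; apply: eq_avg => b.
    have [Zl|_] := boolP (`|Z b| <= l); last by rewrite big1.
    rewrite (bigD1 (Ordinal (binN _ Zl))) //= eqxx big1 ?addr0 // => m.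
    by rewrite -val_eqE /= eq_sym => /negbTE ->.
  have -> : avg (fun b => (`|Z b| <= l)%R%:R : F) =
      1 - avg (fun b => (l < `|Z b|)%R%:R).
    rewrite -[X in X - _](avg_cst 1 W0) -mulN1r -avgZ -avgD.
    by apply: eq_avg => b; rewrite ltNge; case: (_ <= _); rewrite /=; lra.
  have : avg (fun b => (l < `|Z b|)%R%:R) <= 1 / 4 :> F.
    apply: le_trans (avg_rademacher_tail _ l0) _.
    rewrite ler_pdivrMr ?exprn_gt0 //.
    under eq_bigr do rewrite exprMn.
    by rewrite -mulr_suml; lra.
  lra.
(* The left side is the probability that both copies lie in the window and in the same bin, which
   forces distance at most [lam]. *)
have psq : \sum_m p m ^+ 2 <=
    avg (fun b => avg (fun b' => (`|Z b' - Z b| <= lam)%R%:R)).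
  have -> : \sum_m p m ^+ 2 = avg (fun b => avg (fun b' => \sum_(m < N.+1)
      ((`|Z b| <= l)%R && (bin b == m))%:R * ((`|Z b'| <= l)%R && (bin b' == m))%:R)).
    under eq_avg do rewrite avg_sum.
    rewrite avg_sum; apply: eq_bigr => m _.
    under eq_avg do rewrite avgZ mulrC.
    by rewrite avgZ expr2.
  apply: ler_avg => b; apply: ler_avg => b'.
  have [Zb|_] := boolP (`|Z b| <= l); last first.
    by rewrite big1 ?ler0n // => m _; rewrite mul0r.
  have [Zb'|_] := boolP (`|Z b'| <= l); last first.
    by rewrite big1 ?ler0n // => m _; rewrite mulr0.
  rewrite (bigD1 (Ordinal (binN _ Zb))) //= eqxx mul1r big1 ?addr0; last first.
    by move=> m; rewrite -val_eqE /= eq_sym => /negbTE ->; rewrite mul0r.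
  have [E|_] := eqVneq (bin b') (bin b); last by rewrite ler0n.
  suff -> : `|Z b' - Z b| <= lam by [].
  have pos c : `|Z c| <= l -> 0 <= (Z c + l) / lam.
    by rewrite ler_norml => ?; rewrite divr_ge0 ?(ltW lam0) //; lra.
  have /andP[b1 b2] := truncn_itv (pos _ Zb).
  have /andP[b1' b2'] := truncn_itv (pos _ Zb').
  move: b1 b2 b1' b2'; rewrite -/(bin b) -/(bin b') E -natr1.
  rewrite !ler_pdivlMr // !ltr_pdivrMr // ler_norml; lra.
apply: le_trans psq.
have := sqr_sum_le predT p; rewrite cardT size_enum_ord => pp.
have N1 : N.+1%:R <= 3 * l / lam.
  have : (N%:R : F) <= 2 * l / lam by rewrite truncn_le divr_ge0 //; lra.
  have : 1 <= l / lam by rewrite ler_pdivlMr ?mul1r.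
  by rewrite -natr1 -!mulrA; lra.
have {}pp : (3 / 4) ^+ 2 <= 3 * l / lam * \sum_m p m ^+ 2.
  apply: le_trans (ler_wpM2r _ N1); last by apply: sumr_ge0 => m _; exact: sqr_ge0.
  by apply: le_trans pp; rewrite ler_sqr ?nnegrE //; lra.
(* Cauchy-Schwarz over the bins gives [(3/4)^2 * lam / (3 l)]; the claim needs only [3/8] in place
   of [9/16]. *)
have -> : lam / (8 * l) = (lam / (3 * l)) * (3 / 8) by field; lra.
have -> : \sum_m p m ^+ 2 = (lam / (3 * l)) * (3 * l / lam * \sum_m p m ^+ 2).
  by field; lra.
rewrite ler_pM2l; last by rewrite divr_gt0 //; lra.
by apply: le_trans pp; lra.
Qed.

(** Invert [exp (- x) >= 1 - x]: the product of the right side with [1 - x] is [1 + x^2 (1 - 2 x)],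
    at least 1 in this range. *)
Lemma expR_le_quad (x : F) : x <= 1 / 2 -> expR x <= 1 + x + 2 * x ^+ 2.
Proof.
move=> x2; rewrite -[x in expR x]opprK expRN.
have e1 : 1 - x <= expR (- x) by exact: expR_ge1Dx.
apply: (@le_trans _ _ (1 - x)^-1); first by rewrite lef_pV2 ?posrE //; lra.
rewrite -[leLHS]mul1r ler_pdivrMr; last lra.
have : 0 <= x ^+ 2 * (1 - 2 * x) by rewrite mulr_ge0 ?sqr_ge0 //; lra.
by rewrite (_ : (1 + x + 2 * x ^+ 2) * (1 - x) = 1 + x ^+ 2 * (1 - 2 * x));
  [lra | ring].
Qed.

(** For [L <= 1/2] the quadratic bound applies and the linear term averages out; for larger [L] the
    trivial bound [X <= L <= 2 L^2] suffices. *)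
Lemma avg_expR_subgaussian (T : finType) (X : T -> F) (L : F) :
  (0 < #|T|)%N -> avg X = 0 -> (forall w, `|X w| <= L) ->
  avg (fun w => expR (X w)) <= expR (2 * L ^+ 2).
Proof.
move=> T0 X0 XL.
have [L2|L2] := leP L (1 / 2).
  apply: (@le_trans _ _ (avg (fun w => (1 + 2 * L ^+ 2) + X w))).
    apply: ler_avg => w; have wL := XL w.
    have wL1 : X w <= 1 / 2 by apply: le_trans (ler_norm _) _; apply: le_trans L2.
    apply: le_trans (expR_le_quad wL1) _.
    suff : X w ^+ 2 <= L ^+ 2 by lra.
    rewrite -[leLHS]real_normK ?num_real // ler_sqr ?nnegrE ?normr_ge0 //.
    exact: le_trans (normr_ge0 _) wL.
  by rewrite avgD X0 addr0 avg_cst // expR_ge1Dx.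
rewrite -[leRHS](avg_cst _ T0); apply: ler_avg => w; rewrite ler_expR.
have : X w <= L by apply: le_trans (ler_norm _) (XL w).
by nra.
Qed.

End Signs.

(** * The median and the balance of signs of the row errors *)

Section Median.
Variable F : realType.

(** The upper middle entry of the sorted list is at least the median, so it and every entry after it
    exceed [mu]. *)
Lemma median_gt (s : seq F) (mu : F) : (0 < size s)%N -> mu < median s ->
  (size s <= (count (fun a : F => mu < a)%R s).*2)%N.
Proof.
move=> s0; rewrite /median; set t := sort _ s; set m := size s => med.
have tm : size t = m by rewrite size_sort.
have ts : sorted <=%R t by exact: sort_le_sorted.
have tle := sorted_leq_nth le_trans le_refl 0 ts.
have tmu : mu < t`_(m./2).
  move: med; case: ifP => // _ med.
  have : t`_(m./2).-1 <= t`_(m./2).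
    by apply: tle => //; rewrite ?inE ?tm; lia.
  by lra.
have -> : count (fun a : F => mu < a)%R s = count (fun a : F => mu < a)%R t.
  by apply/esym/permP; rewrite perm_sort.
rewrite -(cat_take_drop m./2 t) count_cat.
have /eqP -> : count (fun a : F => mu < a)%R (drop m./2 t) == size (drop m./2 t).
  rewrite -all_count; apply/(all_nthP 0) => j; rewrite size_drop tm => jm; rewrite nth_drop.
  by apply: lt_le_trans tmu _; apply: tle; rewrite ?inE ?tm; lia.
by rewrite size_drop tm; lia.
Qed.

Lemma median_lt (s : seq F) (mu : F) : (0 < size s)%N -> median s < mu ->
  (size s <= (count (fun a : F => a < mu)%R s).*2)%N.
Proof.
move=> s0; rewrite /median; set t := sort _ s; set m := size s => med.
have tm : size t = m by rewrite size_sort.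
have ts : sorted <=%R t by exact: sort_le_sorted.
have tle := sorted_leq_nth le_trans le_refl 0 ts.
(* The index [(m - 1) / 2] is the middle for odd [m] and the lower middle for even [m]. *)
have tmu : t`_(m.-1)./2 < mu.
  move: med; case: ifP => mo med; first by rewrite (_ : (m.-1)./2 = m./2) //; lia.
  have : t`_(m./2).-1 <= t`_(m./2).
    by apply: tle => //; rewrite ?inE ?tm; lia.
  by rewrite (_ : (m.-1)./2 = (m./2).-1); [lra | lia].
have -> : count (fun a : F => a < mu)%R s = count (fun a : F => a < mu)%R t.
  by apply/esym/permP; rewrite perm_sort.
rewrite -(cat_take_drop (m.-1)./2.+1 t) count_cat.
have sz : size (take (m.-1)./2.+1 t) = (m.-1)./2.+1.
  by rewrite size_takel // tm; lia.
have /eqP -> : count (fun a : F => a < mu)%R (take (m.-1)./2.+1 t) ==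
    size (take (m.-1)./2.+1 t).
  rewrite -all_count; apply/(all_nthP 0) => j; rewrite sz => jm; rewrite nth_take //.
  by apply: le_lt_trans tmu; apply: tle; rewrite ?inE ?tm; lia.
by rewrite sz; lia.
Qed.

(** For [lam >= 0], the sign of [e] cut to 0 on [[- lam, lam]]; written as a difference of
    indicators it is odd and its row sums are differences of counts. *)
Definition tsgn (lam e : F) : F := (lam < e)%R%:R - (e < - lam)%R%:R.

Lemma tsgnN (lam e : F) : tsgn lam (- e) = - tsgn lam e.
Proof. by rewrite /tsgn opprB [lam < - e]ltrNr ltrN2. Qed.

Lemma normr_tsgn (lam e : F) : `|tsgn lam e| <= 1.
Proof.
by rewrite /tsgn; case: (_ < _); case: (_ < _);
  rewrite ler_norml /=; lra.
Qed.

Section Rows.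
Variables (R : nat) (a : 'I_R -> F) (mu : F).
Hypothesis R0 : (0 < R)%N.
Let med := median [seq a u | u <- enum 'I_R].

Let count_rows (p : pred F) :
  (count p [seq a u | u <- enum 'I_R])%:R = \sum_u (p (a u))%:R :> F.
Proof.
by rewrite count_map -sum1_count natr_sum big_enum_cond big_mkcond
  /=; apply: eq_bigr => u _; case: (p _).
Qed.

(** If the median is too high, at least half of the rows are above the window:
    [2 up >= R = up + down + small], that is [small <= up - down]. The other side is symmetric. *)
Lemma median_imbalance (lam : F) : 0 <= lam -> lam < `|med - mu| ->
  \sum_u (`|a u - mu| <= lam)%R%:R <= `|\sum_u tsgn lam (a u - mu)|.
Proof.
move=> lam0 lt.
have szR : size [seq a u | u <- enum 'I_R] = R by rewrite size_map size_enum_ord.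
have tot : \sum_u (lam < a u - mu)%R%:R + \sum_u (a u - mu < - lam)%R%:R
    + \sum_u (`|a u - mu| <= lam)%R%:R = R%:R :> F.
  rewrite -!big_split /= -[in RHS](card_ord R) -sum1_card natr_sum.
  apply: eq_bigr => u _; rewrite ler_norml.
  by case: (ltP lam); case: (ltP _ (- lam)) => /=; lra.
have -> : \sum_u tsgn lam (a u - mu) =
    \sum_u (lam < a u - mu)%R%:R - \sum_u (a u - mu < - lam)%R%:R.
  by rewrite -sumrB.
move: lt; rewrite ltr_normr => /orP[lt|lt].
  have : mu + lam < med by lra.
  move/median_gt; rewrite szR => /(_ R0); rewrite -(ler_nat F) -mul2n natrM count_rows.
  under eq_bigr do rewrite addrC -ltrBrDr.
  by move=> H; apply: le_trans (ler_norm _); lra.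
have : med < mu - lam by lra.
move/median_lt; rewrite szR => /(_ R0); rewrite -(ler_nat F) -mul2n natrM count_rows.
under eq_bigr do rewrite -ltrBlDl.
by move=> H; rewrite distrC; apply: le_trans (ler_norm _); lra.
Qed.

(** Otherwise the small rows, a strict majority, would be outnumbered by the imbalance, which is at
    most the number of large rows. *)
Lemma median_close (lam : F) : 0 <= lam ->
  2 * \sum_u (lam < `|a u - mu|)%R%:R < R%:R :> F -> `|med - mu| <= lam.
Proof.
move=> lam0 H; rewrite leNgt; apply/negP => lt.
have := median_imbalance lam0 lt.
have : `|\sum_u tsgn lam (a u - mu)| <= \sum_u (lam < `|a u - mu|)%R%:R.
  apply: le_trans (ler_norm_sum _ _ _) _; apply: ler_sum => u _.
  rewrite ltr_normr /tsgn [_ < - lam]ltrNr.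
  by case: (lam < _); case: (lam < _); rewrite ler_norml /=; lra.
have : \sum_u (`|a u - mu| <= lam)%R%:R + \sum_u (lam < `|a u - mu|)%R%:R
    = R%:R :> F.
  rewrite -!big_split /= -[in RHS](card_ord R) -sum1_card natr_sum.
  by apply: eq_bigr => u _; case: leP => /=; lra.
by lra.
Qed.

End Rows.
End Median.

(** * The tail norm as a sum outside a set of heavy coordinates *)

Section Tail.
Variable F : realType.

Lemma tail_sqE (n : nat) (x : 'I_n -> F) (k : nat) :
  exists2 H : {set 'I_n}, (#|H| <= k)%N & \sum_(j | j \notin H) x j ^+ 2 = tail_sq x k.
Proof.
(* Sorting indices instead of values resolves ties; the sorted values are the image of this list. *)
pose r := sort (relpre (fun i => `|x i|) >=%R) (enum 'I_n).
have rE : perm_eq r (enum 'I_n) by rewrite perm_sort.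
have ru : uniq r by rewrite (perm_uniq rE) enum_uniq.
exists [set i in take k r].
  rewrite cardsE; apply: leq_trans (card_size _) _.
  by rewrite size_take; case: ltnP.
rewrite /tail_sq sort_map -/r -map_drop big_map.
rewrite [RHS](eq_bigr (fun i => x i ^+ 2)); last first.
  by move=> i _; rewrite real_normK ?num_real.
rewrite (@perm_big _ _ _ _ _ r); last first.
  apply: uniq_perm; rewrite ?index_enum_uniq // => i.
  by rewrite mem_index_enum mem_sort mem_enum.
rewrite -[X in \sum_(_ <- X | _) _](cat_take_drop k r) big_cat /= big1_seq ?add0r.
  rewrite big_seq_cond [RHS]big_seq; apply: eq_bigl => i.
  have := ru; rewrite -{1}(cat_take_drop k r) cat_uniq => /and3P[_ /hasPn H _].
  rewrite inE; case: (boolP (i \in drop k r)) => //= /H.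
  by [].
by move=> i /andP[]; rewrite inE => /negbTE ->.
Qed.

End Tail.

(** * From joint tail bounds to exponential moments *)

Section Levels.
Variable F : realType.

Lemma sum_option (T : finType) (f : option T -> F) :
  \sum_o f o = f None + \sum_r f (Some r).
Proof.
rewrite (bigD1 None) //=; congr (_ + _).
rewrite (reindex_omap Some id) => [|[]//].
by apply: eq_bigl => r; rewrite eqxx.
Qed.

Variables (W I K : finType) (S : {set I}) (A : I -> K -> pred W) (G : pred W).
Variables (Y delta : K -> F).
Hypothesis Y0 : forall r, 0 <= Y r.
Hypothesis delta0 : forall r, 0 <= delta r.
Hypothesis Y1 : \sum_r Y r * delta r <= 1.

(* Joint tails that factorise over the indices control the exponential moment
   of the sum over all indices: expand the product over choices of levels. *)
Lemma level_moment :
  (forall f : {ffun I -> option K},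
    avg (fun w => (G w)%:R * \prod_(i in S)
      (if f i is Some r then (A i r w)%:R else 1)) <=
    \prod_(i in S) (if f i is Some r then delta r else 1)) ->
  avg (fun w => (G w)%:R *
    \prod_(i in S) (1 + \sum_r Y r * (A i r w)%:R)) <= 2 ^+ #|S|.
Proof.
move=> joint.
(* The coefficient of a choice of summand at [i]: [None] selects the 1, [Some r] the level [r].
   Outside [S] only [None] has nonzero weight, so each expansion term is counted once. *)
pose cf i (o : option K) : F := if i \in S then (if o is Some r then Y r else 1)
  else (o == None)%:R.
pose b w i (o : option K) : F := if i \in S then
  (if o is Some r then (A i r w)%:R else 1) else 1.
pose c i (o : option K) : F := if i \in S then
  (if o is Some r then delta r else 1) else 1.
have expand (g : I -> K -> F) (g' : I -> option K -> F) :
    (forall i o, g' i o = if i \in S then (if o is Some r then g i r else 1) else 1) ->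
    \prod_(i in S) (1 + \sum_r Y r * g i r) =
    \sum_(f : {ffun I -> option K}) (\prod_i cf i (f i)) * \prod_i g' i (f i).
  move=> g'E; under [RHS]eq_bigr do rewrite -big_split /=.
  rewrite -(bigA_distr_bigA (fun i o => cf i o * g' i o)) /= big_mkcond /=.
  apply: eq_bigr => i _; rewrite sum_option /cf !g'E; case: ifP => iS.
    by rewrite !mulr1; congr (_ + _); apply: eq_bigr => r _; rewrite g'E iS.
  by rewrite eqxx mulr1 big1 ?addr0 // => r _; rewrite mul0r.
have cf0 i o : 0 <= cf i o.
  by rewrite /cf; case: ifP => _; case: o => [r|]; rewrite ?Y0 ?ler0n ?ler01.
apply: (@le_trans _ _ (\sum_(f : {ffun I -> option K})
    (\prod_i cf i (f i)) * \prod_i c i (f i))); last first.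
  rewrite -(expand (fun _ => delta)) // prodr_const.
  rewrite lerXn2r ?nnegrE //; last by have := Y1; rewrite -(lerD2l 1).
  by rewrite addr_ge0 ?sumr_ge0 // => r _; rewrite mulr_ge0.
rewrite (@eq_avg _ _ _ (fun w => \sum_(f : {ffun I -> option K})
    (\prod_i cf i (f i)) * ((G w)%:R * \prod_i b w i (f i)))); last first.
  move=> w; rewrite (expand (fun i r => (A i r w)%:R) (b w)) // mulr_sumr.
  by apply: eq_bigr => f _; rewrite mulrCA.
rewrite avg_sum; apply: ler_sum => f _; rewrite avgZ.
apply: ler_wpM2l; first exact: prodr_ge0.
have := joint f.
rewrite [X in _ <= X -> _]big_mkcond /=; congr (_ <= _); apply: eq_avg => w.
by congr (_ * _); rewrite big_mkcond.
Qed.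

Lemma level_tail (t : F) : 0 < t ->
  (forall f : {ffun I -> option K},
    avg (fun w => (G w)%:R * \prod_(i in S)
      (if f i is Some r then (A i r w)%:R else 1)) <=
    \prod_(i in S) (if f i is Some r then delta r else 1)) ->
  avg (fun w => (G w && (t <= \prod_(i in S) (1 + \sum_r Y r * (A i r w)%:R)))%R%:R)
  <= 2 ^+ #|S| / t.
Proof.
move=> t0 /level_moment H; apply: le_trans (ler_wpM2r _ H); last first.
  by rewrite invr_ge0 ltW.
apply: avg_markov => // [w|w /andP[-> tw]]; last by rewrite mul1r.
rewrite mulr_ge0 ?ler0n ?prodr_ge0 // => i _.
by rewrite addr_ge0 ?sumr_ge0 // => r _; rewrite mulr_ge0 ?ler0n.
Qed.

End Levels.

(** * Summability of the level weights *)

Section Numerics.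
Variable F : realType.

Lemma expR2_ge4 : 4 <= expR (2 : F).
Proof.
have e1 : 2 <= expR (1 : F) by apply: le_trans (expR_ge1Dx _); lra.
by rewrite (_ : 2 = 1 + 1 :> F) // expRD; nra.
Qed.

Lemma level_weights (rho : nat) :
  \sum_(r < rho) expR (16 * 4 ^+ r) * (2 * expR (- (18 * 4 ^+ r))) <= 1 :> F.
Proof.
(* Each term is [2 exp (- 2 * 4^r)], and [4^r >= r + 1] with [exp 2 >= 4] bounds it by
   [2 * 4^-(r+1) <= 2^-(r+1)]. *)
apply: (@le_trans _ _ (\sum_(r < rho) (1 / 2) ^+ r.+1)).
  apply: ler_sum => r _.
  rewrite mulrCA -expRD (_ : _ + _ = (- 2) * 4 ^+ r); last by ring.
  apply: (@le_trans _ _ (2 * expR (- 2 * (r.+1)%:R))).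
    rewrite ler_pM2l // ler_expR ler_nM2l ?ltrN10 //; last by lra.
    rewrite -natrX ler_nat; elim: (r : nat) => // k IH.
    by rewrite expnS; lia.
  rewrite [- 2 * _]mulrC expRM_natl.
  have e4 : expR (- 2 : F) <= 1 / 4.
    by rewrite expRN mul1r lef_pV2 ?posrE ?expR_gt0 // expR2_ge4.
  have : expR (- 2 : F) ^+ r.+1 <= (1 / 4) ^+ r.+1.
    by rewrite lerXn2r ?nnegrE ?expR_ge0 //; lra.
  have : 2 * (1 / 4) ^+ r.+1 <= (1 / 2) ^+ r.+1 :> F.
    have -> : (1 / 4 : F) = (1 / 2) * (1 / 2) by lra.
    rewrite exprMn mulrA; apply: ler_piMl; first by apply: exprn_ge0; lra.
    rewrite exprS mulrA (_ : 2 * (1 / 2) = 1 :> F) ?mul1r; last by lra.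
    by apply: exprn_ile1; lra.
  lra.
suff -> : \sum_(r < rho) (1 / 2) ^+ r.+1 = 1 - (1 / 2) ^+ rho :> F.
  by rewrite gerBl; apply: exprn_ge0; lra.
elim: rho => [|k IH]; first by rewrite big_ord0 expr0 subrr.
by rewrite big_ord_recr /= IH exprS; lra.
Qed.

End Numerics.

(** * Hash tables, row errors and sign flips *)

Section Model.
Variables (F : realType) (R n C : nat).
Local Notation cell := ('I_R * 'I_n)%type.
Local Notation table := {ffun cell -> 'I_C * bool}.

(** Both hash families are stored in one function on (row, element) cells, so that independence
    means disjoint sets of cells; [to_hashes] translates back. *)
Definition bucket (w : table) u i : 'I_C := (w (u, i)).1.
Definition sign (w : table) u i : F := sgnb F (w (u, i)).2.

Definition row_err (x : 'I_n -> F) (w : table) u i : F :=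
  \sum_(j | (j != i) && (bucket w u j == bucket w u i))
    sign w u i * sign w u j * x j.

Definition to_hashes (w : table) : hashes R n C :=
  ([ffun u => [ffun i => (w (u, i)).1]], [ffun u => [ffun i => (w (u, i)).2]]).

Lemma to_hashes_bij : bijective to_hashes.
Proof.
exists (fun h : hashes R n C => [ffun p => (h.1 p.1 p.2, h.2 p.1 p.2)]).
  by move=> w; apply/ffunP => -[u i]; rewrite !ffunE; case: (w _).
by case=> h s; congr pair; apply/ffunP => u; apply/ffunP => i; rewrite !ffunE.
Qed.

Lemma probE (E : pred (hashes R n C)) :
  prob F E = avg (fun w => (E (to_hashes w))%:R : F).
Proof.
rewrite (avg_bij (fun h => (E h)%:R) to_hashes_bij) /prob /avg; congr (_ / _).
rewrite -sum1_card natr_sum [LHS]big_mkcond /=; apply: eq_bigr => h _.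
by rewrite inE; case: (E h).
Qed.

Lemma cs_estimateE (x : 'I_n -> F) (w : table) i :
  cs_estimate (to_hashes w) x i = median [seq row_err x w u i + x i | u <- enum 'I_R].
Proof.
rewrite /cs_estimate; congr median; apply: eq_map => u.
rewrite /sketch /row_err mulr_sumr (bigD1 i) /=; last by rewrite !ffunE.
rewrite addrC mulrA sgnb_sq mul1r; congr (_ + _).
apply: eq_big => j; first by rewrite !ffunE andbC.
by move=> _; rewrite !ffunE mulrA.
Qed.

Section SignFlips.
Variables (x : 'I_n -> F) (S : {set 'I_n}).

Definition flip_signs (a : {ffun cell -> bool}) (w : table) : table :=
  [ffun p => ((w p).1, (w p).2 == a p)].

Lemma flip_signs_inj a : injective (flip_signs a).
Proof.
move=> w w' /ffunP ww'; apply/ffunP => p; have := ww' p; rewrite !ffunE.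
by case: (w p) => v [] ; case: (w' p) => v' []; case: (a p) => -[-> ].
Qed.

Lemma bucket_flip a w u i : bucket (flip_signs a w) u i = bucket w u i.
Proof. by rewrite /bucket ffunE. Qed.

Lemma sign_flip a w u i :
  sign (flip_signs a w) u i = sign w u i * sgnb F (a (u, i)).
Proof. by rewrite /sign ffunE sgnb_eq. Qed.

Lemma row_err_flip a w u i : row_err x (flip_signs a w) u i =
  sign w u i * sgnb F (a (u, i)) *
  \sum_(j | (j != i) && (bucket w u j == bucket w u i))
    sgnb F (a (u, j)) * (sign w u j * x j).
Proof.
rewrite /row_err mulr_sumr; apply: eq_big => j; first by rewrite !bucket_flip.
by move=> _; rewrite !sign_flip; ring.
Qed.

(** Flipping the single sign at [(u, i)] negates the row error, since [i] does not occur in its own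
    noise sum, and [tsgn] is odd. *)
Lemma avg_tsgn_flip (lam : F) w u i :
  avg (fun a => tsgn lam (row_err x (flip_signs a w) u i)) = 0.
Proof.
pose phi (a : {ffun cell -> bool}) : {ffun cell -> bool} :=
  [ffun p => (p == (u, i)) (+) a p].
have phiI : injective phi.
  move=> a b /ffunP ab; apply/ffunP => p; have := ab p; rewrite !ffunE.
  exact: addbI.
set f := fun a => tsgn _ _.
have := avg_reindex f phiI.
have -> : avg (fun a => f (phi a)) = avg (fun a => -1 * f a).
  apply: eq_avg => a; rewrite mulN1r /f -tsgnN !row_err_flip; congr tsgn.
  rewrite ffunE eqxx /= sgnbN mulrN mulNr; congr (- (_ * _)).
  apply: eq_bigr => j /andP[ji _]; rewrite ffunE xpair_eqE eqxx /= (negbTE ji).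
  by [].
by rewrite avgZ; lra.
Qed.

Definition load (w : table) u i : nat := #|[set j in S | bucket w u j == bucket w u i]|.

(* Distinct (row, bucket) pairs use disjoint sets of signs; inside a bucket only
   the zero mean of each term is used, at the price of the load factor. *)
Lemma avg_flip_mgf (lam g : 'I_n -> F) w :
  avg (fun a => expR (\sum_(i in S) g i *
     \sum_u tsgn (lam i) (row_err x (flip_signs a w) u i)))
  <= expR (2 * \sum_(i in S) g i ^+ 2 * (\sum_u load w u i)%:R).
Proof.
have B0 : (0 < #|{: bool}|)%N by rewrite card_bool.
have A0 : (0 < #|{ffun cell -> bool}|)%N by rewrite card_ffun card_bool expn_gt0.
pose X (k : 'I_R * 'I_C) (a : {ffun cell -> bool}) :=
  \sum_(i in S | bucket w k.1 i == k.2)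
    g i * tsgn (lam i) (row_err x (flip_signs a w) k.1 i).
(* The cells of one bucket of one row; the signs on them determine [X k]. *)
pose D (k : 'I_R * 'I_C) : {set cell} := [set p | (p.1 == k.1) && (bucket w k.1 p.2 == k.2)].
have -> : avg (fun a => expR (\sum_(i in S) g i *
     \sum_u tsgn (lam i) (row_err x (flip_signs a w) u i))) =
   avg (fun a => \prod_(k | true) expR (X k a)).
  apply: eq_avg => a; rewrite -expR_sum; congr expR.
  under eq_bigr do rewrite mulr_sumr.
  rewrite exchange_big /= -(pair_bigA _ (fun u v => X (u, v) a)) /=.
  apply: eq_bigr => u _.
  by rewrite (partition_big (bucket w u) xpredT).
rewrite (@avg_indep _ _ _ _ _ D) //; first last.
- move=> [u v] _ a b ab; congr expR; apply: eq_bigr => i /andP[_ /eqP iv].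
  congr (_ * tsgn _ _); rewrite !row_err_flip; congr (_ * _ * _).
    by rewrite ab // inE /= eqxx iv eqxx.
  apply: eq_bigr => j /andP[_ /eqP ji]; rewrite ab //.
  by rewrite inE /= eqxx ji iv eqxx.
- move=> k l _ _; apply: contraR; rewrite -setI_eq0 => /set0Pn[p].
  rewrite !inE => /andP[/andP[/eqP pk /eqP bk] /andP[/eqP pl /eqP bl]].
  rewrite [k]surjective_pairing [l]surjective_pairing -pk -pl -bk -bl -pk -pl.
  by rewrite eqxx.
apply: (@le_trans _ _ (\prod_(k : 'I_R * 'I_C) expR (2 *
    (\sum_(i in S | bucket w k.1 i == k.2) `|g i|) ^+ 2))).
  apply: ler_prod => -[u v] _; rewrite avg_ge0 /=; last by move=> a; exact: expR_ge0.
  apply: avg_expR_subgaussian => // [|a].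
    rewrite avg_sum big1 // => i _.
    by rewrite avgZ avg_tsgn_flip mulr0.
  apply: le_trans (ler_norm_sum _ _ _) _; apply: ler_sum => i _.
  by rewrite normrM ler_piMr // normr_tsgn.
rewrite -expR_sum ler_expR -mulr_sumr ler_pM2l //.
rewrite -(pair_bigA _ (fun u v => (\sum_(i in S | bucket w u i == v) `|g i|) ^+ 2)) /=.
under [leRHS]eq_bigr do rewrite natr_sum mulr_sumr.
rewrite [leRHS]exchange_big /=; apply: ler_sum => u _.
rewrite [leRHS](partition_big (bucket w u) xpredT) //=; apply: ler_sum => v _.
(* Cauchy-Schwarz inside a bucket: its number of elements of [S] is the load of each of them. *)
apply: le_trans (sqr_sum_le _ _) _; rewrite mulr_sumr; apply: ler_sum => i /andP[_ /eqP iv].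
rewrite mulrC real_normK ?num_real // ler_wpM2l ?sqr_ge0 // ler_nat /load iv.
by rewrite cardsE.
Qed.

End SignFlips.
End Model.

(** * Joint tail bound for the imbalance of signs *)

Section Imbalance.
Variables (F : realType) (R n C : nat) (x : 'I_n -> F) (S : {set 'I_n}).
Local Notation cell := ('I_R * 'I_n)%type.
Local Notation table := {ffun cell -> 'I_C * bool}.

Definition imbalance (lam : F) (w : table) i : F :=
  \sum_u tsgn lam (row_err x w u i).

Definition load_ok (w : table) : bool :=
  [forall i in S, \sum_u load S w u i <= 2 * R]%N.

Lemma load_ok_flip a w : load_ok (flip_signs a w) = load_ok w.
Proof.
apply: eq_forallb => i; congr (_ ==> (_ <= _)%N).
apply: eq_bigr => u _; congr #|pred_of_set _|; apply/setP => j.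
by rewrite !inE !bucket_flip.
Qed.

(** A joint Chernoff bound: an auxiliary random sign per index removes the absolute values, after
    which resampling the hash signs with the buckets fixed makes [avg_flip_mgf] applicable. *)
Lemma imbalance_joint (lam theta : 'I_n -> F) (P : pred 'I_n) :
  (forall i, P i -> i \in S) -> (forall i, P i -> 0 <= theta i) ->
  avg (fun w => (load_ok w)%:R *
    \prod_(i | P i) (theta i * R%:R <= `|imbalance (lam i) w i|)%R%:R) <=
  \prod_(i | P i) (2 * expR (- (theta i ^+ 2 * R%:R / 16))).
Proof.
move=> PS th0.
have [C0|C0] := posnP #|{: table}|.
  by rewrite /avg C0 invr0 mulr0 prodr_ge0 // => i _; rewrite mulr_ge0 ?expR_ge0.
have E0 : (0 < #|{ffun 'I_n -> bool}|)%N by rewrite card_ffun card_bool expn_gt0.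
have A0 : (0 < #|{ffun cell -> bool}|)%N by rewrite card_ffun card_bool expn_gt0.
have B0 : (0 < #|{: bool}|)%N by rewrite card_bool.
(* With total load at most [2 R] the exponent is [- g theta R + 4 g^2 R], which is minimal here with
   value [- theta^2 R / 16]. *)
pose g i := theta i / 8.
pose ge (e : {ffun 'I_n -> bool}) i := if P i then sgnb F (e i) * g i else 0.
pose c := \prod_(i | P i) (2 * expR (- (g i * (theta i * R%:R)))).
have c0 : 0 <= c by rewrite prodr_ge0 // => i _; rewrite mulr_ge0 ?expR_ge0.
have step w : \prod_(i | P i) (theta i * R%:R <= `|imbalance (lam i) w i|)%R%:R <=
    c * avg (fun e => expR (\sum_(i in S) ge e i * imbalance (lam i) w i)).
  pose G i b := if P i then expR (sgnb F b * g i * imbalance (lam i) w i) else 1.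
  have -> : avg (fun e => expR (\sum_(i in S) ge e i * imbalance (lam i) w i)) =
      \prod_i avg (G i).
    rewrite -avg_ffun_prod; apply: eq_avg => e.
    rewrite expR_sum big_mkcond; apply: eq_bigr => i _; rewrite /ge /G.
    have := PS i; case: (P i) => [->//|_].
    by case: (i \in S); rewrite // mul0r expR0.
  rewrite [X in _ <= _ * X](bigID P) /= [X in _ * (_ * X)]big1 ?mulr1; last first.
    by move=> i /negbTE Pi; rewrite /G Pi avg_cst.
  rewrite -big_split /=; apply: ler_prod => i Pi; rewrite ler0n /=.
  rewrite /G Pi /avg big_bool card_bool /sgnb mul1r mulN1r.
  set Di := imbalance _ _ _; set a := g i * Di.
  have -> : 2 * expR (- (g i * (theta i * R%:R))) * ((expR a + expR (- g i * Di)) / 2)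
     = expR (a - g i * (theta i * R%:R)) + expR (- a - g i * (theta i * R%:R)).
    by rewrite !expRD mulNr -/a; field.
  have gi0 : 0 <= g i by rewrite divr_ge0 ?th0.
  have [le|_] := boolP (theta i * R%:R <= `|Di|); last by rewrite mulr0n addr_ge0 ?expR_ge0.
  have [D0|D0] := ger0P Di; move: le.
    rewrite ger0_norm // => le; rewrite -[leLHS]addr0 lerD ?expR_ge0 //.
    by rewrite -[leLHS]expR0 ler_expR subr_ge0 ler_wpM2l.
  rewrite ltr0_norm // => le; rewrite -[leLHS]add0r lerD ?expR_ge0 //.
  by rewrite -[leLHS]expR0 ler_expR subr_ge0 -mulrN ler_wpM2l.
apply: (@le_trans _ _ (avg (fun w => c * avg (fun e =>
    (load_ok w)%:R * expR (\sum_(i in S) ge e i * imbalance (lam i) w i))))).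
  apply: ler_avg => w; rewrite avgZ mulrCA.
  by apply: ler_wpM2l; rewrite ?ler0n ?step.
rewrite avgZ exchange_avg.
pose B := expR (4 * R%:R * \sum_(i | P i) g i ^+ 2).
apply: (@le_trans _ _ (c * B)); last first.
  rewrite /c /B mulr_sumr expR_sum -big_split /=; apply: ler_prod => i _.
  rewrite !mulr_ge0 ?expR_ge0 //= -[X in X <= _]mulrA -expRD ler_pM2l //.
  by rewrite ler_expR /g; lra.
apply: ler_wpM2l => //.
rewrite -[leRHS](avg_cst _ E0); apply: ler_avg => e.
rewrite (avg_act _ A0 (@flip_signs_inj R n C)).
rewrite -[leRHS](avg_cst _ C0); apply: ler_avg => w.
under eq_avg do rewrite load_ok_flip.
rewrite avgZ; have [ok|_] := boolP (load_ok w); last by rewrite mul0r expR_ge0.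
rewrite mul1r; apply: le_trans (avg_flip_mgf x S lam (ge e) w) _.
rewrite ler_expR !mulr_sumr [leRHS]big_mkcond [leLHS]big_mkcond /=.
apply: ler_sum => i _; rewrite /ge; have Pi := PS i.
case iS: (i \in S); last by case: (P i) Pi => // /(_ isT); rewrite iS.
case: (P i); last by rewrite expr0n /= mul0r mulr0.
have := implyP (forallP ok i) iS; rewrite -(ler_nat F) natrM => Li.
rewrite exprMn [sgnb F _ ^+ 2]expr2 sgnb_sq mul1r.
by have := sqr_ge0 (g i); nra.
Qed.

End Imbalance.

(** * Joint tail bound for the number of small row errors *)

Section SmallErrors.
Variables (F : realType) (R n C : nat) (x : 'I_n -> F) (S : {set 'I_n}) (l : F).
Hypothesis l0 : 0 < l.
Local Notation cell := ('I_R * 'I_n)%type.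
Local Notation table := {ffun cell -> 'I_C * bool}.
Local Notation coins := {ffun cell -> bool * bool}.

(* Two fair coins per element: it moves to the mirror bucket when they differ,
   and the first one multiplies its sign. *)
Definition scatter (a : coins) (w : table) : table :=
  [ffun p => if p.2 \in S then w p else
    (if (a p).1 == (a p).2 then (w p).1 else rev_ord (w p).1, (w p).2 == (a p).1)].

Lemma scatter_inj a : injective (scatter a).
Proof.
move=> w w' /ffunP ww'; apply/ffunP => p; have := ww' p; rewrite !ffunE.
case: ifP => // _; case: (w p) => v b; case: (w' p) => v' b' /= [].
by case: (a p) => -[] [] /=; case: b; case: b' => //;
  try move/(can_inj (@rev_ordK _)); move=> ->.
Qed.

Definition near (w : table) (u : 'I_R) (i : 'I_n) : {set 'I_n} :=
  [set j | (j != i) && ((bucket w u j == bucket w u i) ||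
                        (rev_ord (bucket w u j) == bucket w u i))].

Definition good (w : table) u i : bool :=
  [&& rev_ord (bucket w u i) != bucket w u i, [disjoint S & near w u i] &
      \sum_(j in near w u i) x j ^+ 2 <= l ^+ 2].

Lemma bucket_scatter a w u i : i \in S ->
  bucket (scatter a w) u i = bucket w u i.
Proof. by move=> iS; rewrite /bucket ffunE iS. Qed.

Lemma near_scatter a w u i : i \in S -> near (scatter a w) u i = near w u i.
Proof.
move=> iS; apply/setP => j; rewrite !inE (bucket_scatter a w u iS); congr (_ && _).
rewrite /bucket ffunE; case: ifP => // _ /=; case: ifP => // _.
by rewrite rev_ordK orbC.
Qed.

Lemma good_scatter a w u i : i \in S -> good (scatter a w) u i = good w u i.
Proof. by move=> iS; rewrite /good near_scatter // bucket_scatter. Qed.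

(** The coefficient of [j] is nonzero exactly when the coins put [j] in the bucket of [i], and then
    equals the sign of the first coin. The exclusive or accounts for the side from which [j]
    starts. *)
Lemma row_err_scatter a w u i : i \in S -> good w u i ->
  row_err x (scatter a w) u i =
  \sum_(j in near w u i)
    ((a (u, j)).1%:R - ((a (u, j)).2 (+) (bucket w u j == bucket w u i))%:R) *
    (sign F w u i * sign F w u j * x j).
Proof.
move=> iS /and3P[rev_i dis _].
rewrite /row_err (bigID (mem (near w u i))) /= [X in _ + X]big1 ?addr0.
  rewrite big_mkcond [RHS]big_mkcond /=; apply: eq_bigr => j _.
  case jn: (j \in near w u i); last by rewrite andbF.
  have jS : j \in S = false by apply: contraTF jn => jS; rewrite (disjointFr dis jS).
  move: jn; rewrite inE andbT => /andP[ji]; rewrite ji /= (bucket_scatter a w u iS).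
  rewrite /sign /bucket !ffunE iS jS /= sgnb_eq.
  case: eqP => [->|/eqP nj] /=.
    move=> _; case: (a (u, j)) => -[] [] /=; rewrite ?eqxx ?(negbTE rev_i) /sgnb /=; lra.
  move/eqP=> ej; rewrite ej.
  by case: (a (u, j)) => -[] [] /=; rewrite ?eqxx ?(negbTE nj) /sgnb /=; lra.
move=> j /andP[/andP[ji bj]] /negP[]; rewrite -(near_scatter a) // inE ji /=.
by rewrite bj.
Qed.

(** Shifting the second coin by fixed bits keeps the two coin families uniform and independent;
    their order matches the difference in [small_ball]. *)
Lemma avg_coins (f : {ffun cell -> bool} -> {ffun cell -> bool} -> F)
    (s : cell -> bool) :
  avg (fun a : coins => f [ffun p => (a p).2 (+) s p] [ffun p => (a p).1]) =
  avg (fun b => avg (f b)).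
Proof.
have -> : avg (fun b => avg (f b)) = avg (fun bb => f bb.1 bb.2).
  by rewrite [RHS]avg_pair.
rewrite -(@avg_bij _ _ _ (fun a : coins =>
  ([ffun p => (a p).2 (+) s p], [ffun p => (a p).1]))) //.
exists (fun bb : {ffun cell -> bool} * {ffun cell -> bool} =>
  [ffun p => (bb.2 p, bb.1 p (+) s p)]) => [a|[b b']].
  by apply/ffunP => p; rewrite !ffunE addbK; case: (a p).
by congr pair; apply/ffunP => p; rewrite !ffunE ?addbK.
Qed.

Lemma avg_scatter_small (lam : F) w u i : i \in S -> good w u i ->
  0 < lam -> lam <= l ->
  lam / (8 * l) <=
  avg (fun a => (`|row_err x (scatter a w) u i| <= lam)%R%:R).
Proof.
move=> iS gi lam0 laml.
(* Extension by zero to all cells, so that [small_ball] applies on the full coin space. *)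
pose y (p : cell) := if (p.1 == u) && (p.2 \in near w u i) then
  sign F w u i * sign F w u p.2 * x p.2 else 0.
have ysum (f : cell -> F -> F) : (forall p, f p 0 = 0) ->
    \sum_p f p (y p) = \sum_(j in near w u i)
      f (u, j) (sign F w u i * sign F w u j * x j).
  move=> f0; transitivity (\sum_v \sum_j f (v, j) (y (v, j))).
    by rewrite pair_bigA /=; apply: eq_bigr => -[].
  rewrite (bigD1 u) //= [X in _ + X]big1 ?addr0; last first.
    by move=> v /negbTE vu; rewrite big1 // => j _; rewrite /y /= vu.
  rewrite [RHS]big_mkcond; apply: eq_bigr => j _; rewrite /y /= eqxx /=.
  by case: ifP.
have yl : \sum_p y p ^+ 2 <= l ^+ 2.
  rewrite (ysum (fun _ z => z ^+ 2)) => [|_]; last by rewrite expr0n.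
  have /and3P[_ _] := gi; congr (_ <= _); apply: eq_bigr => j _.
  by rewrite !exprMn [sign F w u i ^+ 2]expr2 [sign F w u j ^+ 2]expr2 !sgnb_sq !mul1r.
apply: le_trans (small_ball lam0 laml yl) _.
rewrite -(avg_coins _ (fun p => bucket w u p.2 == bucket w u i)).
rewrite le_eqVlt; apply/orP; left; apply/eqP; apply: eq_avg => a.
congr ((_ <= _)%R : nat)%:R; congr `| _ |.
rewrite row_err_scatter // (ysum (fun p z => (_ - _) * z)) => [|p]; last by rewrite mulr0.
by apply: eq_bigr => j _; rewrite !ffunE.
Qed.

Definition n_small (lam : F) (w : table) i : F :=
  \sum_u (`|row_err x w u i| <= lam)%R%:R.

Definition good_ok (w : table) : bool :=
  [forall i in S, R <= 2 * #|[set u | good w u i]|]%N.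

Lemma good_ok_scatter a w : good_ok (scatter a w) = good_ok w.
Proof.
apply: eq_forallb => i; case iS: (i \in S) => //=; congr (_ <= 2 * #|pred_of_set _|)%N.
by apply/setP => u; rewrite !inE good_scatter.
Qed.

(** A common element would put [i'] in the bucket of [i] or in its mirror, whereas a good row has no
    other element of [S] there. *)
Lemma near_disjoint w u i i' : i \in S -> i' \in S -> good w u i -> i != i' ->
  [disjoint near w u i & near w u i'].
Proof.
move=> iS i'S /and3P[_ dis _] ii'; rewrite -setI_eq0; apply/set0Pn => -[j].
rewrite !inE => /andP[/andP[_ ji] /andP[_ ji']].
have := disjointFr dis i'S; rewrite inE eq_sym ii' /=.
move: ji ji' => /orP[] /eqP <- /orP[] /eqP <-; rewrite ?rev_ordK ?eqxx ?orbT //.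
Qed.

Lemma expRN1_le (b : bool) : expR (- b%:R) <= 1 - b%:R / 2 :> F.
Proof.
case: b; last by rewrite oppr0 expR0 mul0r subr0.
have e1 : 2 <= expR (1 : F) by apply: le_trans (expR_ge1Dx _); lra.
rewrite expRN (_ : 1 - 1 / 2 = 2^-1 :> F); last by lra.
by rewrite lef_pV2 ?posrE ?expR_gt0.
Qed.

(** A Chernoff bound over good rows only. By [avg_scatter_small] such a row is small with
    probability at least [128 l theta / (8 l) = 16 theta], so its factor is at most
    [1 - 8 theta <= exp (- 8 theta)]; with at least [R / 2] good rows the exponent is at most
    [theta R - 4 theta R]. *)
Lemma n_small_joint (theta : 'I_n -> F) (P : pred 'I_n) :
  (forall i, P i -> i \in S) -> (forall i, P i -> 0 < theta i) ->
  (forall i, P i -> 128 * l * theta i <= l) ->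
  avg (fun w => (good_ok w)%:R *
    \prod_(i | P i) (n_small (128 * l * theta i) w i < theta i * R%:R)%R%:R) <=
  \prod_(i | P i) expR (- (3 * theta i * R%:R)).
Proof.
move=> PS th0 th1.
have [C0|C0] := posnP #|{: table}|.
  by rewrite /avg C0 invr0 mulr0 prodr_ge0 // => i _; rewrite expR_ge0.
have T0 : (0 < #|{: bool * bool}|)%N by rewrite card_prod card_bool.
have A0 : (0 < #|coins|)%N by rewrite card_ffun expn_gt0 T0.
pose lam i := 128 * l * theta i.
pose f (u : 'I_R) i (w : table) : F := expR (- (`|row_err x w u i| <= lam i)%R%:R).
pose Q w (k : 'I_R * 'I_n) := P k.2 && good w k.1 k.2.
have pairs (h : 'I_R -> 'I_n -> F) w : \prod_(k | Q w k) h k.1 k.2 =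
    \prod_(i | P i) \prod_(u | good w u i) h u i.
  rewrite [LHS]big_mkcond.
  rewrite -(pair_bigA _ (fun u i => if Q w (u, i) then h u i else 1)) /=.
  rewrite exchange_big [RHS]big_mkcond /=; apply: eq_bigr => i _; rewrite /Q /=.
  by case: (P i) => /=; [rewrite [RHS]big_mkcond | rewrite big1].
pose c := \prod_(i | P i) expR (theta i * R%:R).
have c0 : 0 <= c by apply: prodr_ge0 => i _; exact: expR_ge0.
have step w : \prod_(i | P i) (n_small (lam i) w i < theta i * R%:R)%R%:R <=
    c * \prod_(k | Q w k) f k.1 k.2 w.
  rewrite (pairs (fun u i => f u i w)) -big_split /=.
  apply: ler_prod => i Pi; rewrite ler0n /= -expR_sum -expRD sumrN.
  have [lt|_] := ltP (n_small (lam i) w i); last by rewrite expR_ge0.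
  rewrite -[leLHS]expR0 ler_expR subr_ge0; apply: le_trans (ltW lt).
  rewrite /n_small [leRHS](bigID (fun u => good w u i)) /= lerDl.
  by apply: sumr_ge0 => u _; exact: ler0n.
have QS w k : Q w k -> k.2 \in S by case/andP => /PS.
have Qscat a w k : Q (scatter a w) k = Q w k.
  rewrite /Q; case Pk: (P k.2) => //=; exact: good_scatter (PS _ Pk).
apply: (@le_trans _ _ (avg (fun w => (good_ok w)%:R * (c * \prod_(k | Q w k) f k.1 k.2 w)))).
  by apply: ler_avg => w; apply: ler_wpM2l; rewrite ?ler0n ?step.
rewrite (avg_act _ A0 scatter_inj) -[leRHS](avg_cst _ C0); apply: ler_avg => w.
under eq_avg do rewrite good_ok_scatter (eq_bigl _ _ (Qscat _ _)).
rewrite avgZ; have [ok|_] := boolP (good_ok w); last first.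
  by rewrite mul0r prodr_ge0 // => i _; rewrite expR_ge0.
rewrite mul1r avgZ.
(* The coins of the cells near [(u, i)] determine the error there; these sets are disjoint across
   rows, and within a row by [near_disjoint]. *)
rewrite (@avg_indep _ _ _ _ _ (fun k =>
  [set p | (p.1 == k.1) && (p.2 \in near w k.1 k.2)])) //; first last.
- move=> [u i] /= Qk a b ab; have iS := QS _ _ Qk; have /andP[_ gk] := Qk.
  rewrite /f !row_err_scatter //; congr expR; congr (- ((`| _ | <= _)%R : nat)%:R).
  by apply: eq_bigr => j jn; rewrite ab // inE /= eqxx jn.
- move=> [u i] [u' i'] Qk Ql; rewrite xpair_eqE -setI_eq0 => kl.
  apply/set0Pn => -[[v j]]; rewrite finset.in_setI => /andP[].
  rewrite finset.in_set /= => /andP[/eqP -> ji].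
  rewrite finset.in_set /= => /andP[/eqP uu ji'].
  subst u'; rewrite eqxx /= in kl; have /andP[_ gk] := Qk.
  have := near_disjoint (QS _ _ Qk) (QS _ _ Ql) gk kl.
  by move/disjointFr => /(_ _ ji); rewrite ji'.
have per k : Q w k -> avg (fun a => f k.1 k.2 (scatter a w)) <= expR (- (8 * theta k.2)).
  case: k => u i Qk; have iS := QS _ _ Qk; have /andP[Pi gk] := Qk.
  have := avg_scatter_small iS gk _ (th1 _ Pi).
  have -> : 128 * l * theta i / (8 * l) = 16 * theta i by field; rewrite gt_eqF.
  have lam0 : 0 < 128 * l * theta i by rewrite !mulr_gt0 ?th0.
  move/(_ lam0) => sm.
  apply: (@le_trans _ _ (1 - 8 * theta i)); last exact: expR_ge1Dx.
  apply: (@le_trans _ _ (1 + (- 2^-1) * avg (fun a : coins =>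
      (`|row_err x (scatter a w) u i| <= lam i)%R%:R))); last by rewrite /lam; lra.
  rewrite -[X in X + _](avg_cst 1 A0) -avgZ -avgD; apply: ler_avg => a.
  by apply: le_trans (expRN1_le _) _; lra.
apply: (@le_trans _ _ (c * \prod_(k | Q w k) expR (- (8 * theta k.2)))).
  apply: ler_wpM2l => //; apply: ler_prod => k Qk; rewrite per // andbT.
  by apply: avg_ge0 => a; exact: expR_ge0.
rewrite (pairs (fun u i => expR (- (8 * theta i)))) -big_split /=.
apply: ler_prod => i Pi; rewrite -expR_sum sumr_const -expRD expR_ge0 /= ler_expR.
have := implyP (forallP ok i) (PS _ Pi); rewrite cardsE -(ler_nat F) natrM => gR.
rewrite -[_ *+ _]mulr_natr; have := th0 _ Pi.
by set N : F := #|_|%:R in gR *; nra.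
Qed.

End SmallErrors.

(** * Bad rows and heavy loads *)

Section Collisions.
Variables (F : realType) (R n C : nat).
Hypothesis C0 : (0 < C)%N.
Local Notation cell := ('I_R * 'I_n)%type.
Local Notation table := {ffun cell -> 'I_C * bool}.

Let entry0 : (0 < #|{: 'I_C * bool}|)%N.
Proof. by rewrite card_prod card_ord card_bool muln_gt0 C0. Qed.

Let Cp : 0 < (C%:R : F). Proof. by rewrite ltr0n. Qed.

Let table0 : (0 < #|{: table}|)%N.
Proof. by rewrite card_ffun expn_gt0 entry0. Qed.

Lemma avg_bucket (g : 'I_C -> F) :
  avg (fun t : 'I_C * bool => g t.1) = (\sum_v g v) / C%:R.
Proof.
rewrite avg_pair /= /avg card_ord; congr (_ / _); apply: eq_bigr => v _.
by rewrite big_bool card_bool /=; field.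
Qed.

Lemma avg_bucket_eq (v : 'I_C) :
  avg (fun t : 'I_C * bool => (t.1 == v)%:R : F) = C%:R^-1.
Proof.
rewrite (avg_bucket (fun v' => (v' == v)%:R)) (bigD1 v) //= eqxx big1 ?addr0.
  by rewrite mul1r.
by move=> v' /negbTE ->.
Qed.

Lemma avg_fixed u (i : 'I_n) :
  avg (fun w : table => (rev_ord (bucket w u i) == bucket w u i)%:R : F) <= C%:R^-1.
Proof.
rewrite /bucket (avg_coord (u, i) (fun t => (rev_ord t.1 == t.1)%:R)) //.
rewrite (avg_bucket (fun v => (rev_ord v == v)%:R)) ler_piMl ?invr_ge0 ?ler0n //.
rewrite -natr_sum (ler_nat _ _ 1).
(* The mirror map has at most one fixed point, the middle bucket. *)
have [v /eqP rv|nov] := pickP (fun v : 'I_C => rev_ord v == v).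
  rewrite (bigD1 v) //= big1 => [|v' vv']; first by case: (_ == _).
  apply/eqP; rewrite eqb0; apply: contra vv' => /eqP rv'; apply/eqP/val_inj.
  move: (congr1 val rv) (congr1 val rv') => /=; have := ltn_ord v; have := ltn_ord v'.
  lia.
by rewrite big1 // => v _; rewrite nov.
Qed.

Lemma avg_near u (i j : 'I_n) : j != i ->
  avg (fun w : table => (j \in near w u i)%:R : F) <= 2 / C%:R.
Proof.
move=> ji; have pji : (u, j) != (u, i) by rewrite xpair_eqE eqxx.
pose h (v : 'I_C) (t : 'I_C * bool) : F := (t.1 == v)%:R + (t.1 == rev_ord v)%:R.
apply: (@le_trans _ _ (avg (fun w : table =>
    \sum_v h v (w (u, j)) * ((w (u, i)).1 == v)%:R))).
  apply: ler_avg => w; rewrite inE ji /= (bigD1 (bucket w u i)) //= /bucket eqxx mulr1.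
  rewrite big1 ?addr0 => [|v /negbTE vw]; last by rewrite eq_sym vw mulr0.
  rewrite /h -natrD ler_nat [_ == rev_ord _](_ : _ = (rev_ord (w (u, j)).1 == (w (u, i)).1)).
    by case: (_ == _); case: (_ == _).
  by apply/eqP/eqP => [->|<-]; rewrite rev_ordK.
rewrite avg_sum (@eq_bigr _ _ _ _ _ _ _ (fun=> 2 / C%:R / C%:R)) => [|v _].
  by rewrite sumr_const card_ord -[_ *+ _]mulr_natr mulfVK ?gt_eqF.
rewrite (avg_coord2 (h v) (fun t => (t.1 == v)%:R)) // /h avgD !avg_bucket_eq.
by field; rewrite gt_eqF.
Qed.

Lemma avg_rows (phi : 'I_R -> table -> F) :
  (forall u, depends_on [set p | p.1 == u] (phi u)) ->
  avg (fun w => \prod_u phi u w) = \prod_u avg (phi u).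
Proof.
move=> dep; apply: (@avg_indep _ _ _ _ _ (fun u => [set p : cell | p.1 == u])) => //.
move=> u v _ _; apply: contraR; rewrite -setI_eq0 => /set0Pn[p].
by rewrite !inE => /andP[/eqP -> /eqP ->].
Qed.

Section Bad.
Variables (x : 'I_n -> F) (S H : {set 'I_n}) (l : F).
Hypothesis l0 : 0 < l.
Let light j := if j \in H then 0 else x j.

Definition bad (w : table) u i := ~~ good x S l w u i || (l < `|row_err x w u i|).

(** Chebyshev over the signs with buckets fixed; the variance is the light mass in the bucket of
    [i], bounded by that of the bucket and its mirror. *)
Lemma avg_light_tail u i :
  avg (fun w : table => (l < `|row_err light w u i|)%R%:R) <=
  avg (fun w : table => \sum_(j in near w u i) light j ^+ 2) / l ^+ 2.
Proof.
have A0 : (0 < #|{ffun cell -> bool}|)%N by rewrite card_ffun card_bool expn_gt0.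
rewrite (avg_act _ A0 (@flip_signs_inj R n C)) mulrC -avgZ; apply: ler_avg => w.
pose y (p : cell) := if (p.1 == u) && ((p.2 != i) && (bucket w u p.2 == bucket w u i))
  then sign F w u p.2 * light p.2 else 0.
have ysum (f : cell -> F -> F) : (forall p, f p 0 = 0) -> \sum_p f p (y p) =
    \sum_(j | (j != i) && (bucket w u j == bucket w u i))
      f (u, j) (sign F w u j * light j).
  move=> f0; transitivity (\sum_v \sum_j f (v, j) (y (v, j))).
    by rewrite pair_bigA /=; apply: eq_bigr => -[].
  rewrite (bigD1 u) //= [X in _ + X]big1 ?addr0; last first.
    by move=> v /negbTE vu; rewrite big1 // => j _; rewrite /y /= vu.
  by rewrite [RHS]big_mkcond; apply: eq_bigr => j _; rewrite /y /= eqxx /=; case: ifP.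
rewrite (@eq_avg _ _ _ (fun a : {ffun cell -> bool} =>
  (l < `|\sum_p sgnb F (a p) * y p|)%R%:R)); last first.
  move=> a; rewrite row_err_flip !normrM !normr_sgnb !mul1r.
  by rewrite (ysum (fun p z => sgnb F (a p) * z)) // => p; rewrite mulr0.
apply: le_trans (avg_rademacher_tail _ l0) _.
rewrite mulrC ler_wpM2l ?invr_ge0 ?exprn_ge0 ?(ltW l0) //.
rewrite (ysum (fun _ z => z ^+ 2)) => [|_]; last by rewrite expr0n.
rewrite big_mkcond [leRHS]big_mkcond /=; apply: ler_sum => j _.
rewrite inE; case: (j != i) => //=; case: (_ == _) => /=.
  by rewrite exprMn [sign F w u j ^+ 2]expr2 sgnb_sq mul1r.
by case: ifP; rewrite ?sqr_ge0.
Qed.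

(** A union bound: a self-mirrored bucket, a collision with [S] or [H], pair mass above [l^2], error
    above [l]. Without collisions [x] agrees with [light] near [i], so the last two cost at most
    [2 T / (l^2 C)] each, where [T] is the squared mass off [H]. *)
Lemma avg_bad_le u i :
  avg (fun w : table => (bad w u i)%:R) <=
  (1 + 2 * (#|S| + #|H|)%:R + 4 * (\sum_(j | j \notin H) x j ^+ 2) / l ^+ 2) / C%:R.
Proof.
pose Q (w : table) := \sum_(j in near w u i) light j ^+ 2.
pose K (w : table) := \sum_(j in S :|: H | j != i) (j \in near w u i)%:R : F.
have badE (w : table) : (bad w u i)%:R <= (rev_ord (bucket w u i) == bucket w u i)%:R + K w
    + ((l ^+ 2)^-1 * Q w + (l < `|row_err light w u i|)%R%:R).
  have Q0 : 0 <= Q w by apply: sumr_ge0 => j _; exact: sqr_ge0.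
  have K0 : 0 <= K w by apply: sumr_ge0 => j _; exact: ler0n.
  have l20 : 0 < (l ^+ 2)^-1 by rewrite invr_gt0 exprn_gt0.
  have lQ0 : 0 <= (l ^+ 2)^-1 * Q w by rewrite mulr_ge0 // ltW.
  have [rv|nrv] := boolP (rev_ord (bucket w u i) == bucket w u i).
    have b1 : (bad w u i)%:R <= 1 :> F by case: (bad _ _ _).
    by have := ler0n F (l < `|row_err light w u i|)%R; rewrite mulr1n; lra.
  have [/existsP[j /andP[jSH jn]]|noj] :=
      boolP [exists j, (j \in S :|: H) && (j \in near w u i)].
    have b1 : (bad w u i)%:R <= 1 :> F by case: (bad _ _ _).
    have ji : j != i by move: jn; rewrite inE => /andP[].
    have : 1 <= K w.
      rewrite /K (bigD1 j) ?jSH //= jn lerDl.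
      by apply: sumr_ge0 => j' _; exact: ler0n.
    by have := ler0n F (l < `|row_err light w u i|)%R; rewrite mulr0n; lra.
  have nSH j : j \in near w u i -> (j \notin S) && (j \notin H).
    move=> jn; rewrite -negb_or; apply: contra noj => jSH.
    by apply/existsP; exists j; rewrite jn inE jSH.
  have xl j : j \in near w u i -> light j = x j.
    by move=> /nSH /andP[_ jH]; rewrite /light (negbTE jH).
  have eE : row_err x w u i = row_err light w u i.
    apply: eq_bigr => j /andP[ji bj]; rewrite xl //.
    by rewrite inE ji bj.
  have QE : \sum_(j in near w u i) x j ^+ 2 = Q w.
    by apply: eq_bigr => j jn; rewrite xl.
  rewrite /bad /good eE QE nrv /=.
  have -> /= : [disjoint S & near w u i].
    rewrite -setI_eq0; apply/set0Pn => -[j]; rewrite finset.in_setI => /andP[jS /nSH].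
    by rewrite jS.
  have [Ql|Ql] /= := leP (Q w) (l ^+ 2); first by lra.
  have : 1 <= (l ^+ 2)^-1 * Q w by rewrite mulrC ler_pdivlMr ?mul1r ?exprn_gt0 // ltW.
  by have := ler0n F (l < `|row_err light w u i|)%R; rewrite mulr1n mulr0n; lra.
apply: le_trans (ler_avg badE) _; rewrite !avgD avgZ.
have Ci : 0 < C%:R^-1 :> F by rewrite invr_gt0.
have hK : avg K <= 2 * (#|S| + #|H|)%:R / C%:R.
  rewrite /K avg_sum; apply: (@le_trans _ _ (\sum_(j in S :|: H | j != i) 2 / C%:R)).
    by apply: ler_sum => j /andP[_ ji]; exact: avg_near.
  rewrite sumr_const -[_ *+ _]mulr_natr mulrAC ler_pM2r // ler_pM2l // ler_nat.
  apply: (@leq_trans #|S :|: H|); last by rewrite cardsU leq_subr.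
  by apply: subset_leq_card; apply/fintype.subsetP => j; rewrite unfold_in => /andP[].
have hQ : avg Q <= 2 * (\sum_(j | j \notin H) x j ^+ 2) / C%:R.
  rewrite (@eq_avg _ _ _ (fun w =>
    \sum_(j | (j \notin H) && (j != i)) x j ^+ 2 * (j \in near w u i)%:R)).
    rewrite avg_sum [leRHS]mulrAC mulr_sumr.
    apply: (@le_trans _ _ (\sum_(j | (j \notin H) && (j != i)) 2 / C%:R * x j ^+ 2)).
      apply: ler_sum => j /andP[_ ji]; rewrite avgZ mulrC ler_wpM2r ?sqr_ge0 //.
      exact: avg_near.
    rewrite big_mkcondr /=; apply: ler_sum => j _; case: ifP => // _.
    by rewrite mulr_ge0 ?sqr_ge0 // divr_ge0 // ltW.
  move=> w; rewrite /Q big_mkcond [RHS]big_mkcond /=; apply: eq_bigr => j _.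
  rewrite /light; have [jn|_] := boolP (j \in near w u i); last by rewrite mulr0; case: ifP.
  have -> : j != i by move: jn; rewrite inE => /andP[].
  by case: (j \in H) => /=; rewrite ?expr0n ?mulr1.
have l20 : 0 < (l ^+ 2)^-1 by rewrite invr_gt0 exprn_gt0.
have hT := avg_light_tail u i; rewrite -/Q in hT.
have hF := avg_fixed u i.
have : (l ^+ 2)^-1 * avg Q <= (l ^+ 2)^-1 * (2 * (\sum_(j | j \notin H) x j ^+ 2) / C%:R).
  by rewrite ler_pM2l.
move: hT hF hK; rewrite /Q; set a1 := avg _; set a2 := avg _; set a3 := avg _; set a4 := avg _.
set T := \sum_(j | _) _; set N : F := (#|S| + #|H|)%:R.
set li := (l ^+ 2)^-1; set Cinv := C%:R^-1.
move=> *; rewrite (_ : (1 + 2 * N + 4 * T * li) * Cinv =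
  Cinv + 2 * N * Cinv + (li * (2 * T * Cinv) + li * (2 * T * Cinv))); last by ring.
lra.
Qed.

Lemma bad_dep u i : depends_on [set p : cell | p.1 == u] (fun w : table => (bad w u i)%:R : F).
Proof.
move=> w w' ww'; have E j : w (u, j) = w' (u, j) by apply: ww'; rewrite inE.
have bE j : bucket w u j = bucket w' u j by rewrite /bucket E.
have sE j : sign F w u j = sign F w' u j by rewrite /sign E.
have rE : row_err x w u i = row_err x w' u i.
  apply: eq_big => j; first by rewrite !bE.
  by rewrite !sE.
have nE : near w u i = near w' u i by apply/setP => j; rewrite !inE !bE.
by rewrite /bad /good rE nE bE.
Qed.

(** Markov for [z^(2 * number of bad rows)]: each independent row contributes at most
    [1 + (z^2 - 1) q <= 2], and the event makes the product at least [z^R]. *)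
Lemma many_bad (z q : F) i : 1 <= z -> z ^+ 2 * q <= 1 ->
  (forall u, avg (fun w : table => (bad w u i)%:R) <= q) ->
  avg (fun w : table => (R <= 2 * #|[set u | bad w u i]|)%:R) <= (2 / z) ^+ R.
Proof.
move=> z1 zq badq; have z0 : 0 < z by lra.
pose phi u (w : table) : F := 1 + (z ^+ 2 - 1) * (bad w u i)%:R.
have phiE u w : phi u w = if bad w u i then z ^+ 2 else 1.
  by rewrite /phi; case: (bad _ _ _); rewrite ?mulr1 ?mulr0; ring.
have z21 : 1 <= z ^+ 2 by rewrite exprn_ege1.
have phi0 u w : 0 <= phi u w by rewrite phiE; case: ifP => //; lra.
apply: le_trans (avg_markov (f := fun w => \prod_u phi u w) (b := z ^+ R) _ _ _) _.
- exact: exprn_gt0.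
- by move=> w; apply: prodr_ge0.
- move=> w Rb; under eq_bigr do rewrite phiE.
  rewrite -big_mkcond prodr_const -exprM; apply: ler_weXn2l => //.
  by rewrite cardsE in Rb.
rewrite avg_rows => [|u]; last first.
  by move=> w w' ww'; rewrite /phi (bad_dep i ww').
rewrite expr_div_n ler_wpM2r ?invr_ge0 ?exprn_ge0 ?(ltW z0) //.
rewrite -[X in _ ^+ X](card_ord R) -prodr_const; apply: ler_prod => u _.
rewrite avg_ge0 //= /phi avgD avgZ avg_cst //.
suff : (z ^+ 2 - 1) * avg (fun w : table => (bad w u i)%:R) <= 1 by lra.
have b0 : 0 <= avg (fun w : table => (bad w u i)%:R : F) by apply: avg_ge0 => w.
have := badq u; nra.
Qed.

End Bad.

Lemma avg_row_prod (G : 'I_n -> 'I_C * bool -> F) u :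
  avg (fun w : table => \prod_i G i (w (u, i))) = \prod_i avg (G i).
Proof.
have -> : avg (fun w : table => \prod_i G i (w (u, i))) =
    avg (fun w : table => \prod_p (if p.1 == u then G p.2 else fun=> 1) (w p)).
  apply: eq_avg => w.
  transitivity (\prod_v \prod_i (if v == u then G i else fun=> 1) (w (v, i))).
    rewrite (bigD1 u) //= eqxx [X in _ * X]big1 ?mulr1 // => v /negbTE ->.
    by rewrite big1.
  by rewrite pair_bigA; apply: eq_bigr => -[].
rewrite (avg_ffun_prod (fun p => if p.1 == u then G p.2 else fun=> 1)).
transitivity (\prod_v \prod_i avg (if v == u then G i else fun=> 1)).
  by rewrite pair_bigA; apply: eq_bigr => -[].
rewrite (bigD1 u) //= eqxx [X in _ * X]big1 ?mulr1 // => v /negbTE ->.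
by rewrite big1 // => i _; rewrite avg_cst.
Qed.

Lemma avg_load_exp (S : {set 'I_n}) (z : F) u i : 1 <= z -> z * #|S|%:R <= C%:R ->
  avg (fun w : table => z ^+ #|[set j in S | (j != i) && (bucket w u j == bucket w u i)]|)
  <= expR 1.
Proof.
move=> z1 zS.
(* Fixing the bucket [v] of [i] by an indicator makes the average factorise; the other elements of
   [S] contribute at most [(1 + (z - 1) / C)^|S| <= exp (z |S| / C)]. *)
pose G v j (t : 'I_C * bool) : F := if j == i then (t.1 == v)%:R else
  if j \in S then (if t.1 == v then z else 1) else 1.
have -> : avg (fun w : table =>
      z ^+ #|[set j in S | (j != i) && (bucket w u j == bucket w u i)]|) =
    \sum_v avg (fun w : table => \prod_j G v j (w (u, j))).
  rewrite -avg_sum; apply: eq_avg => w; rewrite (bigD1 (bucket w u i)) //=.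
  rewrite [X in _ + X]big1 ?addr0 => [|v vi]; last first.
    by rewrite (bigD1 i) //= /G eqxx -/(bucket w u i) eq_sym (negbTE vi) mul0r.
  rewrite (bigD1 i) //= {1}/G !eqxx mul1r cardsE -prodr_const.
  rewrite big_mkcond [RHS]big_mkcond; apply: eq_bigr => j _.
  rewrite unfold_in /G -/(bucket w u j) /=.
  by case: (j == i); rewrite ?andbF //; case: (j \in S); rewrite //=; case: (_ == _).
pose r : F := expR (z / C%:R).
have r1 : 1 <= r by rewrite -expR0 ler_expR divr_ge0 ?ler0n //; lra.
have row v : avg (fun w : table => \prod_j G v j (w (u, j))) <= C%:R^-1 * expR 1.
  rewrite avg_row_prod (bigD1 i) //= {1}/G eqxx avg_bucket_eq ler_pM2l ?invr_gt0 //.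
  apply: (@le_trans _ _ (r ^+ #|S|)); last first.
    by rewrite /r -expRM_natl ler_expR mulrA ler_pdivrMr // mul1r mulrC.
  rewrite -prodr_const big_mkcond [leRHS]big_mkcond /=; apply: ler_prod => j _.
  have -> : (if j != i then avg (G v j) else 1) =
      if (j != i) && (j \in S) then 1 + (z - 1) / C%:R else 1.
    rewrite /G; case: (j == i) => //=; case: (j \in S); last by rewrite avg_cst.
    rewrite -(avg_bucket_eq v) -avgZ -[X in X + _](avg_cst 1 entry0) -avgD.
    by apply: eq_avg => t; case: (_ == _) => /=; ring.
  case: (j \in S); rewrite ?andbF ?ler01 ?lexx //; case: (j != i) => /=; last by rewrite ler01.
  have zC : 0 <= (z - 1) / C%:R by rewrite divr_ge0 ?ler0n //; lra.
  apply/andP; split; first by lra.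
  apply: le_trans (expR_ge1Dx _) _; rewrite ler_expR ler_pM2r ?invr_gt0 //; lra.
apply: le_trans (ler_sum _ (fun v _ => row v)) _.
by rewrite sumr_const card_ord -[_ *+ _]mulr_natl mulrA mulfV ?mul1r // gt_eqF.
Qed.

(** The element [i] counts itself once per row, so a total load above [2 R] means more than [R]
    genuine collisions; Markov for [z] to their number gives the bound. *)
Lemma heavy_load (S : {set 'I_n}) (z : F) i : i \in S -> 1 <= z -> z * #|S|%:R <= C%:R ->
  avg (fun w : table => (2 * R < \sum_u load S w u i)%N%:R) <= (expR 1 / z) ^+ R.
Proof.
move=> iS z1 zS; have z0 : 0 < z by lra.
pose phi u (w : table) : F :=
  z ^+ #|[set j in S | (j != i) && (bucket w u j == bucket w u i)]|.
have loadE u w : load S w u i =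
    (#|[set j in S | (j != i) && (bucket w u j == bucket w u i)]|).+1.
  rewrite /load (cardsD1 i) inE iS eqxx add1n; congr _.+1; congr #|pred_of_set _|.
  by apply/setP => j; rewrite !inE andbCA.
apply: le_trans (avg_markov (f := fun w => \prod_u phi u w) (b := z ^+ R) _ _ _) _.
- exact: exprn_gt0.
- by move=> w; apply: prodr_ge0 => u _; rewrite exprn_ge0 // ltW.
- move=> w; under eq_bigr do rewrite loadE -add1n.
  rewrite big_split /= sum1_card card_ord => lt.
  rewrite /phi -expr_sum; apply: ler_weXn2l => //.
  by move: lt; rewrite mul2n -addnn ltn_add2l; exact: ltnW.
rewrite avg_rows => [|u]; last first.
  move=> w w' ww'; have E j : w (u, j) = w' (u, j) by apply: ww'; rewrite inE.
  rewrite /phi; congr (z ^+ #|pred_of_set _|); apply/setP => j.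
  by rewrite !inE /bucket !E.
rewrite expr_div_n ler_wpM2r ?invr_ge0 ?exprn_ge0 ?(ltW z0) //.
rewrite -[X in _ ^+ X](card_ord R) -prodr_const; apply: ler_prod => u _.
rewrite avg_load_exp // andbT; apply: avg_ge0 => w; exact: exprn_ge0 (ltW z0).
Qed.

End Collisions.

(** * Concentration of the sum of squared errors *)

Section Concentration.
Variables (F : realType) (R n C : nat) (x : 'I_n -> F) (S : {set 'I_n}) (l : F).
Hypotheses (R0 : (0 < R)%N) (C0 : (0 < C)%N) (l0 : 0 < l).
Local Notation cell := ('I_R * 'I_n)%type.
Local Notation table := {ffun cell -> 'I_C * bool}.

(* In units of (3072 l)^2 / R, the squared level r is 4^r / 2.  The constant
   3072 = 24 * 128 gives threshold r ^ 2 * R / 16 = 18 * 4^r, so that the tail at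
   level r beats the weight exp (8 * 4^(r+1) / 2) = exp (16 * 4^r). *)
Definition level (r : nat) : F := 2 ^+ r * (3072 * l * Num.sqrt (2 * R%:R)^-1).
Definition threshold (r : nat) : F := level r / (128 * l).

Let Rp : 0 < (R%:R : F). Proof. by rewrite ltr0n. Qed.

Lemma level_gt0 r : 0 < level r.
Proof. by rewrite !mulr_gt0 ?exprn_gt0 ?sqrtr_gt0 ?invr_gt0 ?mulr_gt0. Qed.

Lemma level_sq r : level r ^+ 2 = 4 ^+ r * (3072 * l) ^+ 2 / (2 * R%:R).
Proof.
rewrite /level !exprMn sqr_sqrtr; last by rewrite invr_ge0 mulr_ge0 // ltW.
rewrite exprAC (_ : 2 ^+ 2 = 4 :> F); last by ring.
by rewrite !mulrA.
Qed.

Lemma threshold_gt0 r : 0 < threshold r.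
Proof. by rewrite divr_gt0 ?level_gt0 ?mulr_gt0. Qed.

Lemma levelE r : level r = 128 * l * threshold r.
Proof. by rewrite mulrC divfK // mulf_neq0 ?gt_eqF. Qed.

Lemma threshold_sq r : threshold r ^+ 2 * R%:R / 16 = 18 * 4 ^+ r.
Proof.
rewrite /threshold expr_div_n level_sq.
by field; rewrite !gt_eqF.
Qed.

(** An error above [level r] and at most [l] forces one of these two events, by [median_imbalance].
    The guard in the second keeps the level in the range of the small-ball estimate. *)
Definition large_imbalance i r (w : table) : bool :=
  threshold r * R%:R <= `|imbalance x (level r) w i|.
Definition few_small i r (w : table) : bool :=
  (level r <= l) && (n_small x (level r) w i < threshold r * R%:R).

Definition weight (r : nat) : F := expR (16 * 4 ^+ r).
Definition moment (A : 'I_n -> nat -> pred table) i w : F :=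
  1 + \sum_(r < R) weight r * (A i r w)%:R.

Let select (V : Type) (v : V) (h : nat -> V) (f : {ffun 'I_n -> option 'I_R}) i :=
  if f i is Some r then h r else v.

Let prod_select (h : 'I_n -> nat -> F) (f : {ffun 'I_n -> option 'I_R}) :
  \prod_(i in S) (if f i is Some r then h i r else 1) =
  \prod_(i | (i \in S) && isSome (f i)) select 0 (h i) f i.
Proof.
rewrite big_mkcondr /=; apply: eq_bigr => i _.
by rewrite /select; case: (f i).
Qed.

Let expR0_ge r : 0 <= 2 * expR (- (18 * 4 ^+ r)) :> F.
Proof. by rewrite mulr_ge0 ?expR_ge0. Qed.

Lemma imbalance_moment (t : F) : 0 < t ->
  avg (fun w => (load_ok S w && (t <= \prod_(i in S) moment large_imbalance i w))%R%:R)
  <= 2 ^+ #|S| / t.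
Proof.
move=> t0; apply: (level_tail (delta := fun r : 'I_R => 2 * expR (- (18 * 4 ^+ r)))) => //.
- by move=> r; exact: expR_ge0.
- exact: level_weights.
move=> f.
under eq_avg do rewrite (prod_select (fun i r => (large_imbalance i r _)%:R)).
rewrite (prod_select (fun _ r => 2 * expR (- (18 * 4 ^+ r)))).
have PS i : (i \in S) && isSome (f i) -> i \in S by case/andP.
have th0 i : (i \in S) && isSome (f i) -> 0 <= select 0 threshold f i.
  by rewrite /select; case: (f i) => // r; rewrite ltW ?threshold_gt0.
have := @imbalance_joint F R n C x S (select 0 level f) (select 0 threshold f) _ PS th0.
congr (_ <= _).
  apply: eq_avg => w; congr (_ * _); apply: eq_bigr => i /andP[_].
  by rewrite /select; case: (f i).
apply: eq_bigr => i /andP[_]; rewrite /select; case: (f i) => // r _.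
by rewrite threshold_sq.
Qed.

Lemma few_small_moment (t : F) : 0 < t ->
  avg (fun w => (good_ok x S l w && (t <= \prod_(i in S) moment few_small i w))%R%:R)
  <= 2 ^+ #|S| / t.
Proof.
move=> t0; apply: (level_tail (delta := fun r : 'I_R => 2 * expR (- (18 * 4 ^+ r)))) => //.
- by move=> r; exact: expR_ge0.
- exact: level_weights.
move=> f.
under eq_avg do rewrite (prod_select (fun i r => (few_small i r _)%:R)).
rewrite (prod_select (fun _ r => 2 * expR (- (18 * 4 ^+ r)))).
pose P i := (i \in S) && isSome (f i).
(* If a selected level exceeds [l], the guard makes the whole product vanish. *)
have [/forallP ok|] := boolP [forall i, P i ==> (select 0 level f i <= l)]; last first.
  rewrite negb_forall => /existsP[i]; rewrite negb_imply => /andP[Pi nl].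
  rewrite (@eq_avg _ _ _ (fun=> 0)) => [|w].
    rewrite /avg big1 // mul0r; apply: prodr_ge0 => j _.
    by rewrite /select; case: (f j) => [r|]; rewrite ?expR0_ge.
  rewrite (bigD1 i) //=; move: nl; rewrite /select; case: (f i) => [r|]; last by rewrite ltW.
  by rewrite /few_small => /negbTE -> /=; rewrite mul0r mulr0.
have PS i : P i -> i \in S by case/andP.
have th0 i : P i -> 0 < select 1 threshold f i.
  by rewrite /select; case: (f i) => // r; rewrite threshold_gt0.
have th1 i : P i -> 128 * l * select 1 threshold f i <= l.
  move=> Pi; have := implyP (ok i) Pi; move: Pi; rewrite /P /select; case: (f i) => [r|].
    by rewrite levelE.
  by rewrite andbF.
have H := @n_small_joint F R n C x S l l0 (select 1 threshold f) P PS th0 th1.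
apply: le_trans (le_trans _ H) _.
  apply: ler_avg => w; apply: ler_wpM2l; first exact: ler0n.
  apply: ler_prod => i; rewrite -/(P i) => Pi; have := implyP (ok i) Pi; move: Pi.
  rewrite /P /select; case: (f i) => [r|]; last by rewrite andbF.
  by move=> _ rl; rewrite ler0n /few_small rl levelE /=.
apply: ler_prod => i Pi; rewrite expR_ge0 /=; have := implyP (ok i) Pi; move: Pi.
rewrite /P /select; case: (f i) => [r _ rl|]; last by rewrite andbF.
have th := threshold_gt0 r.
(* Levels up to [l] have thresholds so small that [threshold^2 R / 16] is below [3 threshold R], so
   the bound of [n_small_joint] is stronger than required. *)
have t128 : threshold r <= 1 / 128.
  by rewrite ler_pdivrMr ?mulr_gt0 //; lra.
have e0 := expR_gt0 (- (18 * 4 ^+ r) : F).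
apply: (@le_trans _ _ (expR (- (18 * 4 ^+ r)))); last by lra.
rewrite ler_expR lerN2 -threshold_sq.
have : threshold r ^+ 2 * R%:R <= threshold r * (1 / 128) * R%:R.
  by rewrite ler_pM2r // expr2 ler_pM2l.
have : 0 < threshold r * R%:R by rewrite mulr_gt0.
lra.
Qed.

Let mod_ge (A : 'I_n -> nat -> pred table) i w : 1 <= moment A i w.
Proof. by rewrite lerDl sumr_ge0 // => r _; rewrite mulr_ge0 ?expR_ge0 ?ler0n. Qed.

Let moment_ge (A : 'I_n -> nat -> pred table) i w (r : 'I_R) :
  A i r w -> weight r <= moment A i w.
Proof.
move=> Ar; rewrite /moment (bigD1 r) //= Ar mulr1 addrCA lerDl.
by rewrite addr_ge0 ?sumr_ge0 // => r' _; rewrite mulr_ge0 ?expR_ge0 ?ler0n.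
Qed.

(** As [2 R <= 4^R], the levels with index below [R], each paired with its successor, reach every
    error up to [l]. *)
Lemma level_max : l <= level R.
Proof.
rewrite -(@ler_pXn2r _ 2) ?nnegrE ?(ltW l0) ?(ltW (level_gt0 _)) // level_sq.
rewrite ler_pdivlMr ?mulr_gt0 // exprMn.
have R4 : (2 * R%:R : F) <= 4 ^+ R.
  by rewrite -natrX -natrM ler_nat; elim: (R) => // r IH; rewrite expnS; lia.
have l20 : 0 < l ^+ 2 by rewrite exprn_gt0.
have : l ^+ 2 * (2 * R%:R) <= l ^+ 2 * 4 ^+ R by rewrite ler_pM2l.
have : 0 < l ^+ 2 * 4 ^+ R by rewrite mulr_gt0 ?exprn_gt0.
by lra.
Qed.

(** A majority of rows that are not bad keeps the error within [l]. It is then either at most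
    [level 0], where the exponent is at most 0, or between two consecutive levels, where one of the
    two events at the lower level supplies its weight. *)
Lemma error_moment (w : table) i : i \in S ->
  (2 * #|[set u | bad x S l w u i]| < R)%N ->
  expR (8 * ((cs_estimate (to_hashes w) x i - x i) ^+ 2 * R%:R / (3072 * l) ^+ 2 - 1 / 2)) <=
  moment large_imbalance i w * moment few_small i w.
Proof.
move=> iS few; set err := cs_estimate _ x i - x i.
pose a u := row_err x w u i + x i.
have errE : err = median [seq a u | u <- enum 'I_R] - x i by rewrite /err cs_estimateE.
have aK u : a u - x i = row_err x w u i by rewrite addrK.
have err_l : `|err| <= l.
  rewrite errE; apply: median_close => //; first exact: ltW.
  under eq_bigr do rewrite aK.
  apply: le_lt_trans (_ : (2 * #|[set u | bad x S l w u i]|)%:R < _); last by rewrite ltr_nat.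
  rewrite natrM ler_pM2l // cardsE -sum1_card natr_sum [leRHS]big_mkcond /=.
  apply: ler_sum => u _; rewrite unfold_in /bad.
  by case: (l < _); rewrite ?orbT //=; case: ifP.
have tau0 : 0 < (3072 * l) ^+ 2 by rewrite exprn_gt0 ?mulr_gt0.
have scaled r : `|err| <= level r -> err ^+ 2 * R%:R / (3072 * l) ^+ 2 <= 4 ^+ r / 2.
  move=> er; rewrite ler_pdivrMr // -[err ^+ 2]real_normK ?num_real //.
  have : `|err| ^+ 2 <= level r ^+ 2.
    by rewrite ler_sqr ?nnegrE ?normr_ge0 ?(ltW (level_gt0 _)).
  rewrite level_sq ler_pdivlMr ?mulr_gt0 //; lra.
have [e0|e0] := leP `|err| (level 0).
  apply: (@le_trans _ _ 1).
    rewrite -[leRHS]expR0 ler_expR; have := scaled _ e0; rewrite expr0; lra.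
  by rewrite -[leLHS]mulr1; apply: ler_pM.
have [r er1 er2] : exists2 r : 'I_R, level r < `|err| & `|err| <= level r.+1.
  (* The least level dominating the error has index between 1 and [R], so its predecessor is an
     admissible index. *)
  have ex : exists r, `|err| <= level r by exists R; exact: le_trans err_l level_max.
  have := ex_minnP ex; case: ex_minnP => r er rmin _.
  case: r er rmin => [|r] er rmin; first by move: e0; rewrite ltNge er.
  have rR : (r < R)%N by apply: rmin; exact: le_trans err_l level_max.
  by exists (Ordinal rR); rewrite //= ltNge; apply/negP => /rmin; rewrite ltnn.
have wr : expR (8 * (err ^+ 2 * R%:R / (3072 * l) ^+ 2 - 1 / 2)) <= weight r.
  by rewrite ler_expR; have := scaled _ er2; rewrite (exprS 4); lra.
apply: le_trans wr _.
have imb : n_small x (level r) w i <= `|imbalance x (level r) w i|.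
  have := @median_imbalance F R a (x i) R0 (level r) (ltW (level_gt0 r)).
  rewrite -errE => /(_ er1).
  by under eq_bigr do rewrite aK; under [in X in _ <= X -> _]eq_bigr do rewrite aK.
have [big|small] := leP (threshold r * R%:R) `|imbalance x (level r) w i|.
  rewrite -[leLHS]mulr1; apply: ler_pM => //; first exact: expR_ge0.
  exact: (moment_ge (A := large_imbalance)).
rewrite -[leLHS]mul1r; apply: ler_pM => //; first exact: expR_ge0.
apply: (moment_ge (A := few_small)).
by rewrite /few_small (le_lt_trans imb small) andbT (le_trans (ltW er1)).
Qed.

(** Outside the bad-row and heavy-load events, an excessive sum makes the product of all moments at
    least [exp (8 (m - m / 2)) = t^2], so one of the two families has product at least [t]; each
    does so with probability at most [2^m / t <= exp (- m)]. *)
Lemma concentration (z q : F) : 1 <= z -> z ^+ 2 * q <= 1 -> z * #|S|%:R <= C%:R ->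
  (forall u i, avg (fun w : table => (bad x S l w u i)%:R) <= q) ->
  avg (fun w : table => (#|S|%:R * (R%:R)^-1 * (3072 * l) ^+ 2 <
     \sum_(i in S) (cs_estimate (to_hashes w) x i - x i) ^+ 2)%R%:R) <=
  #|S|%:R * ((2 / z) ^+ R + (expR 1 / z) ^+ R) + 2 * expR (- #|S|%:R).
Proof.
move=> z1 zq zS badq.
have table0 : (0 < #|{: table}|)%N.
  by rewrite card_ffun expn_gt0 card_prod card_ord card_bool muln_gt0 C0.
have majority (a b : nat) : (R <= a + b -> 2 * b < R -> R <= 2 * a)%N.
  by clear; lia.
set m := #|S|; pose t : F := expR (2 * m%:R).
have t0 : 0 < t by exact: expR_gt0.
pose E1 i (w : table) : F := (R <= 2 * #|[set u | bad x S l w u i]|)%N%:R.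
pose E2 i (w : table) : F := (2 * R < \sum_u load S w u i)%N%:R.
pose E3 (w : table) : F :=
  (load_ok S w && (t <= \prod_(i in S) moment large_imbalance i w))%R%:R.
pose E4 (w : table) : F :=
  (good_ok x S l w && (t <= \prod_(i in S) moment few_small i w))%R%:R.
have cover w : (m%:R * (R%:R)^-1 * (3072 * l) ^+ 2 <
     \sum_(i in S) (cs_estimate (to_hashes w) x i - x i) ^+ 2)%R%:R <=
    \sum_(i in S) E1 i w + \sum_(i in S) E2 i w + (E3 w + E4 w).
  have E10 : 0 <= \sum_(i in S) E1 i w by apply: sumr_ge0 => i _; exact: ler0n.
  have E20 : 0 <= \sum_(i in S) E2 i w by apply: sumr_ge0 => i _; exact: ler0n.
  have E30 : 0 <= E3 w by exact: ler0n.
  have E40 : 0 <= E4 w by exact: ler0n.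
  have [big|_] := ltP; last by rewrite mulr0n; lra.
  rewrite mulr1n.
  have one (E : 'I_n -> table -> F) (b : 'I_n -> bool) i :
      (forall j, E j w = (b j)%:R) -> i \in S -> b i -> 1 <= \sum_(j in S) E j w.
    move=> Eb iS bi; rewrite (bigD1 i) //= Eb bi lerDl.
    by apply: sumr_ge0 => j _; rewrite Eb ler0n.
  have [/exists_inP[i iS bi]|no1] :=
      boolP [exists i in S, R <= 2 * #|[set u | bad x S l w u i]|]%N.
    have := one E1 _ i (fun=> erefl) iS bi; lra.
  have [/exists_inP[i iS bi]|no2] := boolP [exists i in S, 2 * R < \sum_u load S w u i]%N.
    have := one E2 _ i (fun=> erefl) iS bi; lra.
  have few i : i \in S -> (2 * #|[set u | bad x S l w u i]| < R)%N.
    by move=> iS; rewrite ltnNge; apply: contra no1 => ?; apply/exists_inP; exists i.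
  have lok : load_ok S w.
    apply/forall_inP => i iS; rewrite leqNgt; apply: contra no2 => ?.
    by apply/exists_inP; exists i.
  have gok : good_ok x S l w.
    apply/forall_inP => i iS; apply: majority (few i iS).
    rewrite -[X in (X <= _)%N](card_ord R) -cardsT.
    apply: leq_trans (leq_card_setU _ _); apply: subset_leq_card.
    by apply/fintype.subsetP => u _; rewrite !inE /bad; case: (good _ _ _ _ _ _).
  rewrite /E3 /E4 lok gok /=.
  have prods : t * t <= \prod_(i in S) moment large_imbalance i w *
      \prod_(i in S) moment few_small i w.
    rewrite -big_split /=; apply: (@le_trans _ _ (\prod_(i in S)
      expR (8 * ((cs_estimate (to_hashes w) x i - x i) ^+ 2 * R%:R / (3072 * l) ^+ 2
        - 1 / 2)))).
      rewrite -expR_sum /t -expRD ler_expR -mulr_sumr sumrB sumr_const.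
      rewrite -!mulr_suml -[_ *+ _]mulr_natr -/m.
      have tau0 : 0 < (3072 * l) ^+ 2 by rewrite exprn_gt0 ?mulr_gt0.
      have : m%:R <= (\sum_(i in S) (cs_estimate (to_hashes w) x i - x i) ^+ 2) *
          R%:R / (3072 * l) ^+ 2.
        rewrite ler_pdivlMr // -ler_pdivrMr // mulrAC; exact: ltW.
      lra.
    by apply: ler_prod => i iS; rewrite expR_ge0 /=; apply: error_moment (few _ iS).
  have p0 (A : 'I_n -> nat -> pred table) : 0 <= \prod_(i in S) moment A i w.
    by apply: prodr_ge0 => i _; apply: le_trans (mod_ge _ _ _).
  have [a|a] := leP t (\prod_(i in S) moment large_imbalance i w).
    by rewrite mulr1n; have := ler0n F (t <= \prod_(i in S) moment few_small i w)%R; lra.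
  have [b|b] := leP t (\prod_(i in S) moment few_small i w).
    by rewrite mulr0n mulr1n; lra.
  by have := ltr_pM (p0 large_imbalance) (p0 few_small) a b; rewrite ltNge prods.
apply: le_trans (ler_avg cover) _; rewrite !avgD !avg_sum.
have h1 : \sum_(i in S) avg (E1 i) <= m%:R * (2 / z) ^+ R.
  rewrite mulr_natl -sumr_const; apply: ler_sum => i _.
  by apply: (many_bad C0 z1 zq) => u; exact: badq.
have h2 : \sum_(i in S) avg (E2 i) <= m%:R * (expR 1 / z) ^+ R.
  by rewrite mulr_natl -sumr_const; apply: ler_sum => i iS; exact: heavy_load.
have tm : 2 ^+ m / t <= expR (- m%:R).
  rewrite ler_pdivrMr // /t -expRD (_ : - m%:R + 2 * m%:R = m%:R * 1 :> F); last by ring.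
  rewrite expRM_natl lerXn2r ?nnegrE ?expR_ge0 //.
  by apply: le_trans (expR_ge1Dx _); lra.
have h3 : avg E3 <= expR (- m%:R) by apply: le_trans (imbalance_moment t0) tm.
have h4 : avg E4 <= expR (- m%:R) by apply: le_trans (few_small_moment t0) tm.
lra.
Qed.

End Concentration.

(** * Choice of constants and conclusion *)

(* Reduces a vanishing tail to a positive one: the probability space is finite. *)
Lemma finite_gap (F : realType) (W : finType) (Z : W -> F) :
  exists2 e : F, 0 < e & forall w, 0 < Z w -> e < Z w.
Proof.
pose s := \sum_(w | 0 < Z w) (Z w)^-1.
have s0 : 0 <= s by apply: sumr_ge0 => w Zw; rewrite invr_ge0 ltW.
exists (1 + s)^-1 => [|w Zw]; first by rewrite invr_gt0; lra.
rewrite -[Z w]invrK ltf_pV2 ?posrE ?invr_gt0 //; last by lra.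
rewrite /s (bigD1 w) //= addrCA ltrDl.
by apply: ltr_wpDr => //; apply: sumr_ge0 => v /andP[Zv _]; rewrite invr_ge0 ltW.
Qed.

(** The function [m^d exp (- m)] is maximal at [m = d]; the proof is [ln y <= y - 1] at
    [y = m / d]. *)
Lemma expR_powR_bound (F : realType) (d m : F) : 0 < d -> 0 < m ->
  expR (- m) <= expR (d * ln d - d) / m `^ d.
Proof.
move=> d0 m0; rewrite /powR gt_eqF // -expRN -expRD ler_expR.
have : ln (m / d) <= m / d - 1.
  have md : 0 < m / d by rewrite divr_gt0.
  by have := expR_ge1Dx (ln (m / d)); rewrite lnK ?posrE //; lra.
rewrite ln_div ?posrE // => H.
have : d * (ln m - ln d) <= d * (m / d - 1) by rewrite ler_pM2l.
by rewrite mulrBr mulrBr mulr1 mulrCA mulfV ?gt_eqF // mulr1; lra.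
Qed.

Lemma expR1_ge2 (F : realType) : 2 <= expR (1 : F).
Proof. by apply: le_trans (expR_ge1Dx _); lra. Qed.

(** The base is at most [exp (- A (1 + d))], so its [R]-th power is at most [m^-(1+d)], which
    absorbs the factor [m] of the union bound. *)
Lemma power_tail (F : realType) (d A m a : F) (R : nat) :
  0 < d -> 0 < m -> ln m <= A * R%:R -> 0 <= a -> a <= expR 2 ->
  m * (a / expR (2 + A * (1 + d))) ^+ R <= (m `^ d)^-1.
Proof.
move=> d0 m0 lnm a0 ae; pose B := expR (- (A * (1 + d))).
apply: (@le_trans _ _ (m * B ^+ R)).
  rewrite ler_pM2l // lerXn2r ?nnegrE ?expR_ge0 ?divr_ge0 ?expR_ge0 //.
  by rewrite ler_pdivrMr ?expR_gt0 // -expRD [X in expR X](_ : _ = 2) //; ring.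
rewrite /powR gt_eqF // -expRN -expRM_natl -{1}(lnK (x := m)) ?posrE // -expRD ler_expR.
have : (1 + d) * ln m <= (1 + d) * (A * R%:R) by rewrite ler_pM2l //; lra.
lra.
Qed.

Lemma estimate_tail (F : realType) (d A : F) (n k c R : nat)
    (x : 'I_n -> F) (S : {set 'I_n}) (tau : F) :
  let z := expR (2 + A * (1 + d)) in
  0 < d -> 0 < A ->
  (1 <= k)%N -> (1 <= R)%N -> ln (k%:R : F) <= A * R%:R ->
  z ^+ 2 * (5 + 4 * 3072 ^+ 2) <= c%:R ->
  S != finset.set0 -> (#|S| <= k)%N -> 0 < tau -> tail_sq x k <= k%:R * tau ->
  prob F (fun w : hashes R n (c * k) =>
    \sum_(i in S) (cs_estimate w x i - x i) ^+ 2 > #|S|%:R * (R%:R)^-1 * tau)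
  <= (2 + 2 * expR (d * ln d - d)) / (#|S|%:R `^ d).
Proof.
move=> z d0 A0 k1 R1 lnk cz S0 Sk tau0 tailk.
have z1 : 1 <= z.
  rewrite -expR0 ler_expR; have : 0 < A * (1 + d) by rewrite mulr_gt0 //; lra.
  lra.
have zz : z <= z ^+ 2 by rewrite expr2 ler_peMl //; lra.
have zc : z <= c%:R.
  apply: le_trans cz; apply: le_trans zz _; rewrite ler_peMr ?sqr_ge0 //.
  have : 0 <= 3072 ^+ 2 :> F by exact: sqr_ge0.
  by move: (3072 ^+ 2) => b b0; lra.
have c0 : 0 < (c%:R : F) by lra.
have c1 : (0 < c)%N by rewrite -(ltr_nat F).
have C0 : (0 < c * k)%N by rewrite muln_gt0 c1.
have k0 : 0 < (k%:R : F) by rewrite ltr0n.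
have m1 : (0 < #|S|)%N by rewrite card_gt0.
have m0 : 0 < (#|S|%:R : F) by rewrite ltr0n.
have mk : (#|S|%:R : F) <= k%:R by rewrite ler_nat.
(* Chosen so that the unit [(3072 l)^2] of the levels is [tau]. *)
pose l := Num.sqrt tau / 3072.
have l0 : 0 < l by rewrite divr_gt0 ?sqrtr_gt0.
have tauE : (3072 * l) ^+ 2 = tau.
  by rewrite /l mulrC divfK ?sqr_sqrtr ?(ltW tau0) // pnatr_eq0.
have [H Hk HT] := tail_sqE x k.
(* With [|S|], [|H|] at most [k] and tail at most [k tau], the numerator in [avg_bad_le] is at most
   [k (5 + 4 * 3072^2)], and [C = c k] cancels [k]. *)
pose q : F := (5 + 4 * 3072 ^+ 2) / c%:R.
have badq (u : 'I_R) i :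
    avg (fun w : {ffun 'I_R * 'I_n -> 'I_(c * k) * bool} => (bad x S l w u i)%:R) <= q.
  apply: le_trans (avg_bad_le C0 x S H l0 u i) _.
  have Hk' : (#|H|%:R : F) <= k%:R by rewrite ler_nat.
  have k1' : 1 <= (k%:R : F) by rewrite (ler_nat _ 1).
  have tl : 4 * tail_sq x k / l ^+ 2 <= 4 * (k%:R * 3072 ^+ 2).
    by rewrite -mulrA ler_pM2l // ler_pdivrMr ?exprn_gt0 // -mulrA -exprMn tauE.
  rewrite HT /q natrM ler_pdivrMr ?mulr_gt0 // mulrA divfK ?gt_eqF //.
  move: Hk' mk k1' tl; rewrite natrD; clear.
  by move: (3072 ^+ 2) (4 * _ / _) => b t; lra.
have zq : z ^+ 2 * q <= 1 by rewrite mulrA ler_pdivrMr // mul1r.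
have zS : z * #|S|%:R <= (c * k)%:R.
  by rewrite natrM; apply: ler_pM => //; exact: le_trans z1.
have := concentration R1 C0 l0 z1 zq zS badq.
rewrite tauE -(probE F (fun w : hashes R n (c * k) =>
  #|S|%:R * R%:R^-1 * tau < \sum_(i in S) (cs_estimate w x i - x i) ^+ 2)).
move/le_trans; apply.
have zB a : 0 <= a -> a <= expR 2 -> #|S|%:R * (a / z) ^+ R <= (#|S|%:R `^ d)^-1.
  by apply: power_tail => //; apply: le_trans lnk; rewrite ler_ln.
have [e1 e2] : 2 <= expR 1 :> F /\ expR 1 <= expR 2 :> F.
  by split; [exact: expR1_ge2 | rewrite ler_expR ler1n].
have b1 : #|S|%:R * (2 / z) ^+ R <= (#|S|%:R `^ d)^-1.
  by apply: zB => //; exact: le_trans e1 e2.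
have b2 : #|S|%:R * (expR 1 / z) ^+ R <= (#|S|%:R `^ d)^-1.
  by apply: zB => //; exact: expR_ge0.
apply: le_trans (_ : _ <= 2 * (#|S|%:R `^ d)^-1 +
  2 * (expR (d * ln d - d) / #|S|%:R `^ d)) _; last by rewrite mulrA -mulrDl.
rewrite mulrDr; apply: lerD; first by rewrite [leRHS]mulr_natl [leRHS]mulr2n lerD.
by rewrite ler_pM2l // expR_powR_bound.
Qed.

Theorem theorem6p5 (F : realType) (d A : F) :
  0 < d -> 0 < A ->
  exists (c0 : nat) (K : F),
    forall (n k c R : nat), (1 <= n)%N -> (1 <= k)%N -> (c0 <= c)%N ->
    (1 <= R)%N -> ln (k%:R : F) <= A * R%:R ->
    forall (x : 'I_n -> F) (S : {set 'I_n}),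
      S != finset.set0 -> (#|S| <= k)%N ->
      prob F (fun w : hashes R n (c * k) =>
              \sum_(i in S) (cs_estimate w x i - x i) ^+ 2 >
              #|S|%:R * (R%:R)^-1 * (tail_sq x k / k%:R))
      <= K / (#|S|%:R `^ d).
Proof.
move=> d0 A0.
pose z := expR (2 + A * (1 + d)).
(* The first constant gives [z^2 q <= 1]. In the second, 2 pays for the two union bounds over [S]
   and the rest for the two terms [exp (- |S|)]. *)
exists (Num.truncn (z ^+ 2 * (5 + 4 * 3072 ^+ 2))).+1, (2 + 2 * expR (d * ln d - d)).
move=> n k c R _ k1 cc R1 lnk x S S0 Sk.
have cz : z ^+ 2 * (5 + 4 * 3072 ^+ 2) <= c%:R.
  by apply: le_trans (ltW (truncnS_gt _)) _; rewrite ler_nat.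
have k0 : 0 < (k%:R : F) by rewrite ltr0n.
have tail0 : 0 <= tail_sq x k by apply: sumr_ge0 => v _; exact: sqr_ge0.
move: tail0; rewrite le_eqVlt => /predU1P[T0|T0]; last first.
  apply: (estimate_tail d0 A0) => //; first by rewrite divr_gt0.
  by rewrite mulrCA mulfV ?mulr1 ?gt_eqF.
pose Z (w : hashes R n (c * k)) := \sum_(i in S) (cs_estimate w x i - x i) ^+ 2.
have [e e0 gap] := finite_gap Z.
have m0 : 0 < #|S|%:R * (R%:R)^-1 :> F.
  by rewrite divr_gt0 ?ltr0n // card_gt0.
(* For a zero tail, this positive [tau] puts the target exactly at the gap [e], so a positive error
   sum already exceeds it. *)
pose tau := e / (#|S|%:R * (R%:R)^-1).
apply: le_trans (estimate_tail (tau := tau) d0 A0 k1 R1 lnk cz S0 Sk _ _).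
- rewrite /prob ler_wpM2r ?invr_ge0 ?ler0n // ler_nat; apply: subset_leq_card.
  apply/fintype.subsetP => w; rewrite !inE -T0 mul0r mulr0 /tau mulrC divfK ?gt_eqF //.
  exact: gap.
- by rewrite divr_gt0.
- by rewrite -T0 mulr_ge0 ?divr_ge0 // ltW.
Qed.
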